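(* Let $d\geq 4$ be an integer. Then the following are true. (1) There are relatively prime integers $c_{\vec a}$, indexed by vectors $\vec a$ of non-negative integers of arbitrary positive length with $|\vec a|\le d$ and all but finitely many equal to zero, such that for all positive integers $n$ we have $$\sum_{|\vec a|\leq d}c_{\vec a}\,M_{\vec a}(n)\geq 0,$$ and for $n\geq 2$ this expression vanishes if and only if $n$ is prime. (2) As $d\to\infty$, there are $\gg d^2$ many linearly independent expressions satisfying (1). That is, there are constants $C>0$ and $d_0$ such that for every $d\geq d_0$ there are at least $Cd^2$ expressions $\sum_{|\vec a|\leq d}c_{\vec a}M_{\vec a}(n)$ as in (1) which are linearly independent as functions of $n\in\mathbb{Z}_{\ge 1}$.
   Context: For an integer $a\geq 1$ and a vector $\vec a=(v_1,\dots,v_a)$ of non-negative integers, put $|\vec a|:=v_1+\cdots+v_a$, and define the MacMahonesque partition function, for positive integers $n$, by $$M_{\vec a}(n):=\sum_{\substack{0<s_1<s_2<\cdots<s_a\\ m_1,\dots,m_a>0\\ n=m_1s_1+\cdots+m_as_a}} m_1^{v_1}m_2^{v_2}\cdots m_a^{v_a},$$ where the $s_i$ and $m_i$ are integers. ''Relatively prime'' means that the greatest common divisor of all the coefficients $c_{\vec a}$ is $1$. *)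

(* Defs.v *)
From HB Require Import structures.
From mathcomp Require Import all_boot all_order all_algebra.
From mathcomp Require Import finmap.
From mathcomp Require Import reals.

Set Implicit Arguments.
Unset Strict Implicit.
Unset Printing Implicit Defensive.

Import Order.TTheory GRing.Theory Num.Theory.

Local Open Scope nat_scope.

(* A vector (v_1, ..., v_a) is a [seq nat] of size a, so that |v| is [sumn v].

   The range 'I_n.+1 of the s_i and m_i loses nothing: they are positive and
   m_i s_i <= n, hence s_i <= n and m_i <= n. *)
Definition macmahon (v : seq nat) (n : nat) : nat :=
  \sum_(s : {ffun 'I_(size v) -> 'I_n.+1})
    \sum_(m : {ffun 'I_(size v) -> 'I_n.+1} |
       [&& [forall i : 'I_(size v), 0 < s i],
           [forall i : 'I_(size v), forall j : 'I_(size v), (i < j) ==> (s i < s j)],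
           [forall i : 'I_(size v), 0 < m i]
         & n == \sum_(i < size v) m i * s i])
      \prod_(i < size v) m i ^ nth 0 v i.

Definition coeffs := {fsfun seq nat -> int with 0%R}.

Definition coeffs_bounded (d : nat) (c : coeffs) : Prop :=
  forall v : seq nat, c v <> 0%R -> 0 < size v /\ sumn v <= d.

Definition coeffs_gcd (c : coeffs) : nat :=
  \big[gcdn/0]_(v <- finsupp c) `|c v|%N.

Definition expression (c : coeffs) (n : nat) : int :=
  (\sum_(v <- finsupp c) c v * (macmahon v n)%:Z)%R.

Definition prime_detecting (d : nat) (c : coeffs) : Prop :=
  [/\ coeffs_bounded d c,
      coeffs_gcd c = 1,
      forall n : nat, 0 < n -> (0 <= expression c n)%R
    & forall n : nat, 2 <= n -> (expression c n = 0%R <-> prime n)].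

(* Only the values at n >= 1 count. *)
Definition lin_indep (R : realType) (N : nat) (f : 'I_N -> nat -> int) : Prop :=
  forall a : 'I_N -> R,
    (forall n : nat, 0 < n -> (\sum_(k < N) a k * (f k n)%:~R = 0)%R) ->
    forall k : 'I_N, a k = 0%R.

(* Main.v *)
From HB Require Import structures.
Require Import Defs.
From mathcomp Require Import all_boot all_order all_algebra.
From mathcomp Require Import finmap.
From mathcomp Require Import reals.
From mathcomp Require Import zify ring lra.

Set Implicit Arguments.
Unset Strict Implicit.
Unset Printing Implicit Defensive.

Import Order.TTheory GRing.Theory Num.Theory.

Local Open Scope ring_scope.

(** Why the theorem is true.

Write sigma_k(n) for the sum of t^k over the divisors t of n.  For l > 0 the
function
  D(n) = n^j ((n^l + 1) sigma_0(n) - 2 sigma_l(n))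
       = n^j * sum over t | n of (n^l + 1 - 2 t^l)
detects primes: the terms of t = 1 and t = n cancel, and a proper divisor
t > 1 satisfies 2 t^l <= n^l, so that it contributes a positive amount
[detector_eq0], [detector_ge0].  At n = 1 the value is 0.

What has to be shown is that D is a rational combination of the M_v with
|v| <= 2l + 2j.  Since sigma_k = M_(k), this follows from one closure property
[mac_span_mul_nat]: if f is a combination of M_v with |v| <= d, then n f(n) is
a combination of M_v with |v| <= d + 2.

The closure property compares two evaluations of the convolution of sigma_1
with M_v.  A choice of s_1 > ... > s_a and of m_1, ..., m_a > 0 with
sum m_i s_i = n is a partition of n with a distinct parts s_i and
multiplicities m_i.  Convolving with sigma_1 adds k copies of a part s, where
(s, k) carries weight k or, by the symmetry of a divisor with its codivisor,
weight s.  Either s is a new part (insertion), or s is already a part, whose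
multiplicity then grows by k (merging); this is [stuffle].

- With weight k, and polynomial weights in the m_i, both insertion and merging
  give polynomials in the multiplicities, of degree at most |v| + 2: a merged
  multiplicity m contributes the sum over 0 < k < m of k (m - k)^e, which is a
  polynomial in m of degree e + 2.  So the convolution lies in the span
  [mac_span_sigma_product].
- Conjugating partitions exchanges the part sizes with the partial sums
  m_1 + ... + m_i, hence polynomial weights in the s_i and in the m_i give the
  same functions of n, with the same degrees [part_sum_conj].  With a
  weight G(s_1, ..., s_a), weight s for the added part, merging gives
  sum over i of (m_i - 1) s_i G(s) = n G(s) - (s_1 + ... + s_a) G(s), so the
  convolution is n M_v(n) plus elements of the span [sigma_product_conj].

For the lower bound on the number of expressions, take 1 <= l <= d/4 and
0 <= j < d/4.  At n = pq with distinct primes p and q the function D equals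
2 (pq)^j (p^l - 1)(q^l - 1).  A linear relation holds for all p and q, hence is
an identity of polynomials in two variables, in which the monomial
x^(j+l) y^j occurs only in the term of (l, j) [detector_family_free].
Finally a rational combination becomes one with coprime integer coefficients
after multiplication by a positive rational number
[mac_span_coprime_expression]. *)

(** * Sums over partitions and the stuffle product *)

Section PathSum.
Variables (R : rel (nat * nat)) (N : nat).

(** Sums over the lists of length [a] that form an [R]-path from [x], with entries
    below [N].  Writing them as nested sums lets identities be proved by peeling
    off the first entry; the bound [N] keeps every sum finite and is harmless as
    soon as the weight vanishes on lists of too large an area. *)
Fixpoint psum (a : nat) (x : nat * nat) (W : seq (nat * nat) -> rat) : rat :=
  if a is a'.+1 then
    \sum_(0 <= s < N) \sum_(0 <= m < N | R x (s, m))
       psum a' (s, m) (fun L => W ((s, m) :: L))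
  else W [::].

Lemma eq_psum a x W W' :
  (forall L, size L = a -> path R x L -> W L = W' L) ->
  psum a x W = psum a x W'.
Proof.
elim: a x W W' => [|a IH] x W W' eqW /=; first exact: eqW.
apply: eq_bigr => s _; apply: eq_bigr => m Rm.
by apply: IH => L sL pL; apply: eqW; rewrite /= ?sL ?Rm.
Qed.

Lemma psumD a x W W' :
  psum a x (fun L => W L + W' L) = psum a x W + psum a x W'.
Proof.
elim: a x W W' => [|a IH] x W W' //=.
rewrite -big_split; apply: eq_bigr => s _.
by rewrite -big_split; apply: eq_bigr => m Rm; rewrite IH.
Qed.

Lemma psumZ a x c W : psum a x (fun L => c * W L) = c * psum a x W.
Proof.
elim: a x W => [|a IH] x W //=.
rewrite mulr_sumr; apply: eq_bigr => s _.
by rewrite mulr_sumr; apply: eq_bigr => m Rm; rewrite IH.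
Qed.

Lemma psum0 a x W :
  (forall L, size L = a -> path R x L -> W L = 0) -> psum a x W = 0.
Proof.
move=> W0; rewrite (@eq_psum _ _ _ (fun=> 0 * 0)); last by rewrite mul0r.
by rewrite psumZ mul0r.
Qed.

Lemma psum_sum a x (I : Type) (r : seq I) (W : I -> seq (nat * nat) -> rat) :
  psum a x (fun L => \sum_(i <- r) W i L) = \sum_(i <- r) psum a x (W i).
Proof.
elim: r => [|i r IH].
  by rewrite big_nil psum0 // => L _ _; rewrite big_nil.
rewrite big_cons -IH -psumD; apply: eq_psum => L _ _.
by rewrite big_cons.
Qed.

(** The same sum over one index set, where a change of variables acting on the
    whole list (its reversal) can be carried out. *)
Lemma psum_tuple a x W :
  psum a x W =
  \sum_(t : a.-tuple ('I_N * 'I_N) |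
          path R x [seq (val p.1, val p.2) | p <- t])
     W [seq (val p.1, val p.2) | p <- t].
Proof.
elim: a x W => [|a IH] x W /=.
  rewrite (eq_bigl (fun t => t == [tuple])); first by rewrite big_pred1_eq.
  by move=> t; rewrite tuple0 eqxx.
transitivity (\sum_(p : 'I_N * 'I_N | R x (val p.1, val p.2))
    \sum_(t : a.-tuple ('I_N * 'I_N) |
        path R (val p.1, val p.2) [seq (val q.1, val q.2) | q <- t])
      W ((val p.1, val p.2) :: [seq (val q.1, val q.2) | q <- t])).
  rewrite big_mkord.
  transitivity (\sum_(s < N) \sum_(m < N | R x (val s, val m))
      psum a (val s, val m) (fun L => W ((val s, val m) :: L))).
    by apply: eq_bigr => s _; rewrite big_mkord.
  by rewrite pair_big_dep /=; apply: eq_bigr => p _; rewrite IH.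
rewrite pair_big_dep /=.
rewrite (reindex (fun q : ('I_N * 'I_N) * a.-tuple ('I_N * 'I_N) =>
    [tuple of q.1 :: q.2])) /=; first exact: eq_bigr.
exists (fun t : a.+1.-tuple ('I_N * 'I_N) => (thead t, [tuple of behead t])).
  move=> [p t] _ /=; rewrite theadE; congr pair; exact: val_inj.
by move=> t _ /=; rewrite -tuple_eta.
Qed.

End PathSum.

Arguments psum : simpl never.

Lemma psumS0 R N x W : psum R N 0 x W = W [::].
Proof. by []. Qed.

(** A path from [(N, 0)] is a partition: parts below [N], listed decreasingly,
    each with its positive multiplicity. *)
Definition part_rel : rel (nat * nat) :=
  fun x y => (0 < y.1 < x.1)%N && (0 < y.2)%N.

(** A path from [(N, 0)] is the list of the outer corners of a Ferrers diagram. *)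
Definition corner_rel : rel (nat * nat) :=
  fun x y => (0 < y.1 < x.1)%N && (x.2 < y.2)%N.

Lemma psumS R N a x W :
  psum R N a.+1 x W =
  \sum_(0 <= s < N) \sum_(0 <= m < N | R x (s, m))
     psum R N a (s, m) (fun L => W ((s, m) :: L)).
Proof. by []. Qed.

Lemma psum_part_fst N a s m m' W :
  psum part_rel N a (s, m) W = psum part_rel N a (s, m') W.
Proof. by case: a. Qed.

Lemma psum_partS N a x W :
  psum part_rel N a.+1 x W =
  \sum_(0 <= s < N | (0 < s < x.1)%N) \sum_(0 <= m < N | (0 < m)%N)
     psum part_rel N a (s, m) (fun L => W ((s, m) :: L)).
Proof.
rewrite psumS [RHS]big_mkcond; apply: eq_bigr => s _; rewrite /part_rel /=.
by case: ifP => _ //=; rewrite big_pred0.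
Qed.

Definition ins_sum (F : nat * nat -> seq (nat * nat) -> rat) (L : seq (nat * nat)) :=
  \sum_(0 <= i < size L) F (nth (0, 0)%N L i) (take i L ++ drop i.+1 L).

Definition mrg_sum (F : nat * nat -> seq (nat * nat) -> rat) (L : seq (nat * nat)) :=
  \sum_(0 <= i < size L) \sum_(1 <= k < (nth (0, 0)%N L i).2)
    F ((nth (0, 0)%N L i).1, k)
      (take i L ++ ((nth (0, 0)%N L i).1, (nth (0, 0)%N L i).2 - k)%N :: drop i.+1 L).

Lemma ins_sum_cons F x L :
  ins_sum F (x :: L) = F x L + ins_sum (fun y K => F y (x :: K)) L.
Proof. by rewrite /ins_sum /= big_nat_recl //= drop0. Qed.

Lemma mrg_sum_cons F x L :
  mrg_sum F (x :: L) =
  \sum_(1 <= k < x.2) F (x.1, k) ((x.1, x.2 - k)%N :: L)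
  + mrg_sum (fun y K => F y (x :: K)) L.
Proof. by rewrite /mrg_sum /= big_nat_recl //= drop0. Qed.

Lemma sum_nat_as_cond N a b (f : nat -> rat) : (b <= N)%N ->
  \sum_(a <= k < b) f k = \sum_(0 <= k < N | (a <= k < b)%N) f k.
Proof.
move=> bN; rewrite (big_nat_widen _ _ N) // (big_nat_widenl _ 0) //.
by apply: eq_bigl => k; rewrite andbC.
Qed.

(** Merging: the multiplicities [i] and [j] of a part add up to [m]. *)
Lemma sum_antidiagonal N (f : nat -> nat -> rat) :
  (forall i j, (N <= i + j)%N -> f i j = 0) ->
  \sum_(0 <= i < N | (0 < i)%N) \sum_(0 <= j < N | (0 < j)%N) f i j =
  \sum_(0 <= m < N | (0 < m)%N) \sum_(1 <= k < m) f k (m - k)%N.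
Proof.
move=> f0.
transitivity (\sum_(0 <= m < N | (0 < m)%N)
    \sum_(0 <= k < N | (0 < k < m)%N) f k (m - k)%N); last first.
  rewrite big_nat_cond [RHS]big_nat_cond; apply: eq_bigr => m /andP[/andP[_ mN] _].
  by rewrite -sum_nat_as_cond // ltnW.
rewrite [RHS](exchange_big_dep_nat (fun k => (0 < k)%N)) /=; last by move=> i j; lia.
rewrite big_nat_cond [RHS]big_nat_cond; apply: eq_bigr => i /andP[/andP[_ iN] i0].
transitivity (\sum_(1 <= j < N - i) f i j).
  rewrite (@sum_nat_as_cond N) ?leq_subr //.
  rewrite (bigID (fun j => (j < N - i)%N)) /= [X in _ + X]big1 ?addr0 //.
  by move=> j h; apply: f0; lia.
transitivity (\sum_(1 + i <= m < N) f i (m - i)%N).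
  by rewrite big_addn; apply: eq_bigr => j _; rewrite addnK.
rewrite (@sum_nat_as_cond N) // big_nat_cond [RHS]big_nat_cond.
by apply: eq_bigl => j; lia.
Qed.

Lemma sum_trichotomy N h (A : nat -> nat -> rat) :
  (h <= N)%N ->
  \sum_(0 <= i < N | (0 < i < h)%N) \sum_(0 <= j < N | (0 < j < h)%N) A i j =
  \sum_(0 <= i < N | (0 < i < h)%N) \sum_(0 <= j < N | (0 < j < i)%N) A i j
  + \sum_(0 <= j < N | (0 < j < h)%N) \sum_(0 <= i < N | (0 < i < j)%N) A i j
  + \sum_(0 <= i < N | (0 < i < h)%N) A i i.
Proof.
move=> hN.
rewrite [X in _ = _ + X + _](exchange_big_dep_nat (fun i => (0 < i < h)%N)) /=;
  last by move=> i j; lia.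
rewrite -!big_split /= big_nat_cond [RHS]big_nat_cond.
apply: eq_bigr => i /andP[/andP[_ iN] ih].
rewrite (bigID (fun j => (j < i)%N)) /= -addrA; congr +%R.
  by apply: eq_bigl => j; lia.
rewrite (bigID (fun j => (i < j)%N)) /=; congr +%R.
  by apply: eq_bigl => j; lia.
rewrite (eq_bigl (pred1 i)); last by move=> j /=; lia.
by rewrite big_nat1_eq /= iN.
Qed.

(** Adding [m] copies of a part [s] to a partition either creates a part or
    enlarges a multiplicity.  The hypothesis on [F] makes the merged
    multiplicities stay below the bound. *)
Lemma stuffle N a x (F : nat * nat -> seq (nat * nat) -> rat) :
  (x.1 <= N)%N ->
  (forall s k m L1 L2, (0 < s)%N -> (N <= k + m)%N ->
     F (s, k) (L1 ++ (s, m) :: L2) = 0) ->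
  \sum_(0 <= s < N | (0 < s < x.1)%N) \sum_(0 <= m < N | (0 < m)%N)
     psum part_rel N a x (F (s, m)) =
  psum part_rel N a.+1 x (ins_sum F) + psum part_rel N a x (mrg_sum F).
Proof.
elim: a x F => [|a IH] x F xN F0.
  have mrg0 : mrg_sum F [::] = 0 by rewrite /mrg_sum big_geq.
  rewrite psum_partS !psumS0 mrg0 addr0.
  apply: eq_bigr => s _; apply: eq_bigr => m _.
  by rewrite !psumS0 ins_sum_cons /ins_sum big_geq ?addr0.
pose T y z := psum part_rel N a z (fun L => F y (z :: L)).
pose A i j := \sum_(0 <= k < N | (0 < k)%N) \sum_(0 <= m < N | (0 < m)%N) T (i, k) (j, m).
transitivity (\sum_(0 <= i < N | (0 < i < x.1)%N) \sum_(0 <= j < N | (0 < j < x.1)%N) A i j).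
  apply: eq_bigr => i _; rewrite [RHS]exchange_big_nat /=; apply: eq_bigr => k _.
  by rewrite psum_partS.
rewrite sum_trichotomy // !(psum_partS _ _ x) /=.
have -> : \sum_(0 <= s < N | (0 < s < x.1)%N) \sum_(0 <= m < N | (0 < m)%N)
     psum part_rel N a.+1 (s, m) (fun L => ins_sum F ((s, m) :: L)) =
  \sum_(0 <= i < N | (0 < i < x.1)%N) \sum_(0 <= j < N | (0 < j < i)%N) A i j +
  \sum_(0 <= s < N | (0 < s < x.1)%N) \sum_(0 <= m < N | (0 < m)%N)
     psum part_rel N a.+1 (s, m) (ins_sum (fun y K => F y ((s, m) :: K))).
  rewrite -big_split; apply: eq_bigr => i _ /=.
  rewrite /A [X in _ = X + _]exchange_big_nat /= -big_split; apply: eq_bigr => k _ /=.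
  rewrite /T -(psum_partS N a (i, k) (F (i, k))).
  transitivity (psum part_rel N a.+1 (i, k) (fun L => F (i, k) L + ins_sum (fun y K => F y ((i, k) :: K)) L)).
    by apply: eq_psum => L _ _; rewrite ins_sum_cons.
  by rewrite psumD psum_partS.
have -> : \sum_(0 <= s < N | (0 < s < x.1)%N) \sum_(0 <= m < N | (0 < m)%N)
     psum part_rel N a (s, m) (fun L => mrg_sum F ((s, m) :: L)) =
  \sum_(0 <= i < N | (0 < i < x.1)%N) A i i +
  \sum_(0 <= s < N | (0 < s < x.1)%N) \sum_(0 <= m < N | (0 < m)%N)
     psum part_rel N a (s, m) (mrg_sum (fun y K => F y ((s, m) :: K))).
  rewrite -big_split; apply: eq_bigr => i /andP[i0 _] /=.
  rewrite /A sum_antidiagonal => [|k m km]; last first.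
    by apply: psum0 => L _ _; apply: (F0 i k m [::] L).
  rewrite -big_split; apply: eq_bigr => m _ /=.
  transitivity (psum part_rel N a (i, m) (fun L =>
      \sum_(1 <= k < m) F (i, k) ((i, m - k)%N :: L)
      + mrg_sum (fun y K => F y ((i, m) :: K)) L)).
    by apply: eq_psum => L _ _; rewrite mrg_sum_cons.
  rewrite psumD psum_sum; congr +%R; apply: eq_bigr => k _.
  exact: psum_part_fst.
rewrite -!addrA; congr +%R.
rewrite addrC [RHS]addrCA; congr +%R.
rewrite -big_split big_nat_cond [RHS]big_nat_cond.
apply: eq_bigr => j /andP[/andP[_ jN] j0] /=.
rewrite /A.
under eq_bigr => i _ do rewrite exchange_big_nat /=.
rewrite exchange_big_nat /= -big_split; apply: eq_bigr => m _ /=.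
rewrite -IH //=.
- by case/andP: j0 => _ /ltnW h; apply: leq_trans h xN.
- by move=> s k m' L1 L2 s0 km; apply: (F0 s k m' ((j, m) :: L1) L2).
Qed.

(** * Conjugation of partitions *)

Definition area (L : seq (nat * nat)) : nat := \sum_(p <- L) p.1 * p.2.

Lemma area_cons p L : area (p :: L) = (p.1 * p.2 + area L)%N.
Proof. by rewrite /area big_cons. Qed.

Lemma area_cat L L' : area (L ++ L') = (area L + area L')%N.
Proof. by rewrite /area big_cat. Qed.

(** The height of a corner is the number of parts at least as large as it,
    counted with multiplicity; [lo] is the height reached before the list. *)
Fixpoint corners (lo : nat) (L : seq (nat * nat)) : seq (nat * nat) :=
  if L is (s, m) :: L' then (s, lo + m)%N :: corners (lo + m) L' else [::].

(** The area of the diagram, cut into vertical strips between consecutive heights. *)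
Fixpoint corner_area (lo : nat) (K : seq (nat * nat)) : nat :=
  if K is (s, u) :: K' then ((u - lo) * s + corner_area u K')%N else 0%N.

(** Reflecting a diagram in the diagonal exchanges the coordinates of its corners
    and the order in which they are met. *)
Definition conj_corners (K : seq (nat * nat)) : seq (nat * nat) :=
  rev [seq (p.2, p.1) | p <- K].

Lemma corner_area_corners lo L : corner_area lo (corners lo L) = area L.
Proof.
elim: L lo => [|[s m] L IH] lo /=; first by rewrite /area big_nil.
by rewrite area_cons IH addKn mulnC.
Qed.

(** Replacing multiplicities by their partial sums is a bijection onto corner
    lists, except that the heights may exceed the bound [N], where [C] vanishes. *)
Lemma psum_corners N a hi lo (C : seq (nat * nat) -> rat) :
  (forall K, path corner_rel (hi, lo) K ->
     has (fun p => N <= p.2)%N K -> C K = 0) ->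
  psum part_rel N a (hi, lo) (fun L => C (corners lo L)) =
  psum corner_rel N a (hi, lo) C.
Proof.
elim: a hi lo C => [|a IH] hi lo C C0 //.
rewrite psum_partS psumS big_mkcond; apply: eq_bigr => s _ /=.
case: ifP => sR; last by rewrite big_pred0 // => m; rewrite /corner_rel /= sR.
pose f u := psum corner_rel N a (s, u) (fun K => C ((s, u) :: K)).
have f0 u : (lo < u)%N -> (N <= u)%N -> f u = 0.
  move=> lou Nu; apply: psum0 => K _ pK; apply: C0; last by rewrite /= Nu.
  by rewrite /= /corner_rel /= sR lou.
transitivity (\sum_(0 <= m < N | (0 < m)%N) f (lo + m)%N).
  apply: eq_bigr => m m0; rewrite (@psum_part_fst _ _ _ _ (lo + m)) /f -IH //.
  move=> K pK hK; apply: C0; last by rewrite /= hK orbT.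
  by rewrite /= pK andbT /corner_rel /= sR; lia.
transitivity (\sum_(lo.+1 <= u < N) f u); last first.
  rewrite (@sum_nat_as_cond N) // big_nat_cond [RHS]big_nat_cond.
  by apply: eq_bigl => u; rewrite /corner_rel /= sR /=; lia.
have -> : lo.+1 = (1 + lo)%N by lia.
rewrite big_addn (@sum_nat_as_cond N) ?leq_subr //.
rewrite [LHS](bigID (fun j => (j < N - lo)%N)) /= [X in _ + X]big1 ?addr0.
  by apply: eq_bigr => m _; rewrite addnC.
by move=> m h; apply: f0; lia.
Qed.

Lemma path_corner_conj N K :
  all (fun p => (p.1 < N) && (p.2 < N))%N K ->
  path corner_rel (N, 0%N) K = path corner_rel (N, 0%N) (conj_corners K).
Proof.
pose r : rel (nat * nat) := fun x y => (y.1 < x.1)%N && (x.2 < y.2)%N.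
have E J : all (fun p => (p.1 < N) && (p.2 < N))%N J ->
  path corner_rel (N, 0%N) J =
  all (fun p => (0 < p.1) && (0 < p.2))%N J && sorted r J.
  have aux x L : (0 < x.1)%N -> (0 < x.2)%N ->
    path corner_rel x L = all (fun p => (0 < p.1) && (0 < p.2))%N L && path r x L.
    elim: L x => [|y L IH] x x1 x2 //=; rewrite /corner_rel /r /=.
    have [y1|_] := boolP (0 < y.1)%N; last by [].
    have [y2|y2] := boolP (0 < y.2)%N; last first.
      by case: (ltnP x.2 y.2) => h; rewrite ?andbF //=; lia.
    by rewrite IH //= andbCA.
  case: J => [|y J] //= /andP[/andP[y1 y2] _]; rewrite /corner_rel /=.
  rewrite y1 andbT.
  have [h1|] := boolP (0 < y.1)%N => //=.
  have [h2|] := boolP (0 < y.2)%N => //=.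
  by rewrite aux.
move=> bK; rewrite !E //; last first.
  by rewrite /conj_corners all_rev all_map; apply: sub_all bK => p /=; rewrite andbC.
rewrite /conj_corners all_rev all_map rev_sorted; congr andb.
  by apply: eq_all => p /=; rewrite andbC.
rewrite sorted_map; case: K {bK} => //= y K.
by apply: eq_path => u v /=; rewrite /r /= andbC.
Qed.

Lemma psum_conj N a (C : seq (nat * nat) -> rat) :
  psum corner_rel N a (N, 0%N) C =
  psum corner_rel N a (N, 0%N) (fun K => C (conj_corners K)).
Proof.
rewrite !psum_tuple.
pose swap (p : 'I_N * 'I_N) := (p.2, p.1).
pose h (t : a.-tuple ('I_N * 'I_N)) := [tuple of rev (map_tuple swap t)].
have hK : involutive h.
  move=> t; apply: val_inj; rewrite /= map_rev revK -map_comp map_id_in //.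
  by case.
rewrite (reindex_inj (inv_inj hK)).
have hE t : [seq (val p.1, val p.2) | p <- h t] =
   conj_corners [seq (val p.1, val p.2) | p <- t].
  by rewrite /conj_corners /= map_rev -!map_comp.
apply: eq_big => t; last by rewrite hE.
rewrite hE -path_corner_conj // all_map.
by apply/allP => p _ /=; rewrite !ltn_ord.
Qed.

Definition largest_part (K : seq (nat * nat)) : nat := (head (0, 0)%N K).1.

(** The area again, cut into strips between consecutive part sizes.  That both
    cuts give the same number is Abel summation [corner_area_rowsE], and
    conjugation turns one cut into the other [corner_area_conj]. *)
Fixpoint corner_area_rows (K : seq (nat * nat)) : nat :=
  if K is (s, u) :: K' then (u * (s - largest_part K') + corner_area_rows K')%N else 0%N.

Lemma corner_area_rowsE hi lo K : path corner_rel (hi, lo) K ->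
  (corner_area lo K + lo * largest_part K)%N = corner_area_rows K.
Proof.
elim: K hi lo => [|[s u] K IH] hi lo /=; first by rewrite /largest_part /= muln0.
case/andP=> /andP[/= s0 lou] pK; rewrite -(IH s u) //.
rewrite addnAC -mulnDl subnK 1?ltnW // [RHS]addnCA addnC; congr addn.
rewrite -mulnDr subnK //; case: K pK {IH} => [|[s' u'] K] //=.
by rewrite /largest_part /corner_rel /=; lia.
Qed.

Lemma corner_area_rcons lo K p :
  corner_area lo (rcons K p) = (corner_area lo K + (p.2 - last lo (unzip2 K)) * p.1)%N.
Proof.
elim: K lo => [|[s u] K IH] lo /=; first by case: p => s u /=; rewrite addn0.
by rewrite IH addnA.
Qed.

Lemma corner_area_conj K : corner_area 0 (conj_corners K) = corner_area_rows K.
Proof.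
elim: K => [|[s u] K IH] //=.
rewrite /conj_corners /= rev_cons corner_area_rcons /= -/(conj_corners K) IH.
rewrite addnC mulnC; congr (_ * (_ - _) + _)%N.
rewrite /conj_corners /unzip2 map_rev -map_comp /largest_part.
by case: K {IH} => [|y K] //=; rewrite rev_cons last_rcons.
Qed.

Fixpoint cumsum (V : nmodType) (x : V) (xs : seq V) : seq V :=
  if xs is y :: ys then (x + y) :: cumsum (x + y) ys else [::].

Lemma unzip1_corners lo L : unzip1 (corners lo L) = unzip1 L.
Proof. by elim: L lo => [|[s m] L IH] lo //=; rewrite IH. Qed.

Lemma unzip2_corners lo L : unzip2 (corners lo L) = cumsum lo (unzip2 L).
Proof. by elim: L lo => [|[s m] L IH] lo //=; rewrite IH. Qed.

Lemma corner_area_ge hi lo K p : path corner_rel (hi, lo) K -> p \in K ->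
  (p.2 <= lo + corner_area lo K)%N.
Proof.
elim: K hi lo => [|[s u] K IH] hi lo //= /andP[/andP[/= s0 lou] pK].
have su : (u - lo <= (u - lo) * s)%N by apply: leq_pmulr; case/andP: s0.
rewrite inE => /orP[/eqP-> /=|pKm]; first by lia.
have := IH _ _ pK pKm; move: su lou.
by move: (p.2) ((u - lo) * s)%N (corner_area u K) => /= q x y; clear; lia.
Qed.

(** Conjugation on weights: pass to corners, reflect, and come back, so that the
    part sizes turn into the reversed partial sums of multiplicities. *)
Lemma psum_weight_conj N a (W : seq nat -> rat) (phi : nat -> rat) :
  (forall k, (N <= k)%N -> phi k = 0) ->
  psum part_rel N a (N, 0%N) (fun L => W (unzip1 L) * phi (area L)) =
  psum part_rel N a (N, 0%N)
    (fun L => W (rev (cumsum 0%N (unzip2 L))) * phi (area L)).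
Proof.
move=> phi0.
have vanish (V : seq (nat * nat) -> rat) K : path corner_rel (N, 0%N) K ->
    has (fun p => N <= p.2)%N K -> V K * phi (corner_area 0 K) = 0.
  move=> pK /hasP[p pinK Np]; rewrite phi0 ?mulr0 //.
  by rewrite (leq_trans Np) // -[leqRHS]add0n (corner_area_ge pK).
transitivity (psum corner_rel N a (N, 0%N)
    (fun K => W (unzip1 K) * phi (corner_area 0 K))).
  rewrite -psum_corners; last exact: (vanish (fun K => W (unzip1 K))).
  by apply: eq_psum => L _ _; rewrite corner_area_corners unzip1_corners.
rewrite psum_conj.
transitivity (psum corner_rel N a (N, 0%N)
    (fun K => W (rev (unzip2 K)) * phi (corner_area 0 K))).
  apply: eq_psum => K _ pK; rewrite corner_area_conj -(corner_area_rowsE pK) addn0.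
  by congr (W _ * _); rewrite /conj_corners /unzip1 map_rev -map_comp.
rewrite -psum_corners; last exact: (vanish (fun K => W (rev (unzip2 K)))).
by apply: eq_psum => L _ _; rewrite corner_area_corners unzip2_corners.
Qed.

(** * Polynomial weights and power sums *)

Definition monomial (v : seq nat) (x : seq rat) : rat :=
  \prod_(0 <= i < size v) x`_i ^+ nth 0%N v i.

(** Given by a monomial expansion because each monomial is the weight of one
    [macmahon v], and the degree at most [d] is then the bound on [sumn v]. *)
Definition poly_fun (a d : nat) (W : seq rat -> rat) : Prop :=
  exists2 l : seq (rat * seq nat),
    all (fun p => (size p.2 == a) && (sumn p.2 <= d)%N) l &
    forall x, size x = a -> W x = \sum_(p <- l) p.1 * monomial p.2 x.

Lemma poly_fun_ext a d W W' :
  (forall x, size x = a -> W x = W' x) -> poly_fun a d W -> poly_fun a d W'.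
Proof. by move=> e [l bl El]; exists l => // x sx; rewrite -e // El. Qed.

Lemma poly_fun_le a d d' W : (d <= d')%N -> poly_fun a d W -> poly_fun a d' W.
Proof.
move=> dd' [l bl El]; exists l => //; apply: sub_all bl => p /andP[-> pd] /=.
exact: leq_trans dd'.
Qed.

Lemma poly_fun_monomial d v :
  (sumn v <= d)%N -> poly_fun (size v) d (monomial v).
Proof.
move=> vd; exists [:: (1, v)]; first by rewrite /= eqxx vd.
by move=> x _; rewrite big_seq1 mul1r.
Qed.

Lemma poly_funD a d W W' :
  poly_fun a d W -> poly_fun a d W' -> poly_fun a d (fun x => W x + W' x).
Proof.
move=> [l bl El] [l' bl' El']; exists (l ++ l'); first by rewrite all_cat bl.
by move=> x sx; rewrite big_cat /= -El // -El'.
Qed.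

Lemma poly_funZ a d c W : poly_fun a d W -> poly_fun a d (fun x => c * W x).
Proof.
move=> [l bl El]; exists [seq (c * p.1, p.2) | p <- l]; first by rewrite all_map.
move=> x sx; rewrite big_map El // mulr_sumr.
by apply: eq_bigr => p _ /=; rewrite mulrA.
Qed.

Lemma poly_fun0 a d : poly_fun a d (fun=> 0).
Proof. by exists [::] => // x _; rewrite big_nil. Qed.

Lemma poly_fun_sum a d (I : eqType) (r : seq I) (P : pred I) (W : I -> seq rat -> rat) :
  (forall i, i \in r -> P i -> poly_fun a d (W i)) ->
  poly_fun a d (fun x => \sum_(i <- r | P i) W i x).
Proof.
elim: r => [|i r IH] Wp.
  by apply: poly_fun_ext (poly_fun0 a d) => x _; rewrite big_nil.
have Hr : poly_fun a d (fun x => \sum_(i <- r | P i) W i x).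
  by apply: IH => j jr; apply: Wp; rewrite inE jr orbT.
have [Pi|nPi] := boolP (P i).
  apply: poly_fun_ext (poly_funD (Wp i (mem_head _ _) Pi) Hr) => x _.
  by rewrite big_cons Pi.
by apply: poly_fun_ext Hr => x _; rewrite big_cons (negPf nPi).
Qed.

Lemma poly_fun_const a d c : poly_fun a d (fun=> c).
Proof.
have sn : sumn (nseq a 0%N) = 0%N by rewrite sumn_nseq.
have := @poly_fun_monomial d (nseq a 0%N); rewrite sn size_nseq => /(_ isT).
move=> /(poly_funZ c); apply: poly_fun_ext => x _.
rewrite /monomial big_nat big1 ?mulr1 // => i /andP[_ ia].
by rewrite nth_nseq if_same expr0.
Qed.

Lemma poly_fun_coord a i : (i < a)%N -> poly_fun a 1 (fun x => x`_i).
Proof.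
move=> ia; pose v := mkseq (fun j => (j == i) : nat) a.
have sv : size v = a by rewrite size_mkseq.
have vE : sumn v = 1%N.
  rewrite sumnE big_map.
  rewrite (bigD1_seq i) ?iota_uniq ?mem_iota //= eqxx big1 //.
  by move=> j /negPf->.
have := @poly_fun_monomial 1 v; rewrite vE sv => /(_ isT).
apply: poly_fun_ext => x _; rewrite /monomial sv.
rewrite (bigD1_seq i) ?iota_uniq ?mem_iota ?subn0 //= nth_mkseq // eqxx expr1.
rewrite big1_seq ?mulr1 // => j /andP[/negPf ji]; rewrite mem_index_iota => ja.
by rewrite nth_mkseq ?ji.
Qed.

Lemma sumn_big_nth v : sumn v = (\sum_(0 <= i < size v) nth 0 v i)%N.
Proof. by rewrite sumnE (big_nth 0%N). Qed.

Lemma poly_funM a d d' W W' :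
  poly_fun a d W -> poly_fun a d' W' ->
  poly_fun a (d + d') (fun x => W x * W' x).
Proof.
move=> [l bl El] [l' bl' El'].
apply: (@poly_fun_ext _ _ (fun x => \sum_(p <- l) \sum_(p' <- l')
   (p.1 * p'.1) * (monomial p.2 x * monomial p'.2 x))).
  move=> x sx; rewrite El // El' // mulr_suml; apply: eq_bigr => p _.
  by rewrite mulr_sumr; apply: eq_bigr => p' _; rewrite mulrACA.
apply: poly_fun_sum => p /(allP bl)/andP[/eqP sp dp] _.
apply: poly_fun_sum => p' /(allP bl')/andP[/eqP sp' dp'] _.
apply: poly_funZ.
pose v := mkseq (fun i => nth 0 p.2 i + nth 0 p'.2 i)%N a.
have sv : size v = a by rewrite size_mkseq.
have := @poly_fun_monomial (d + d') v.
have -> : sumn v = (sumn p.2 + sumn p'.2)%N.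
  rewrite !sumn_big_nth sv sp sp' -big_split big_nat [RHS]big_nat.
  by apply: eq_bigr => i /andP[_ ia]; rewrite nth_mkseq.
rewrite sv leq_add // => /(_ isT).
apply: poly_fun_ext => x _; rewrite /monomial sp sp' sv -big_split /=.
rewrite big_nat [RHS]big_nat; apply: eq_bigr => i /andP[_ ia].
by rewrite nth_mkseq // exprD.
Qed.

Lemma poly_funX a d k W : poly_fun a d W -> poly_fun a (k * d) (fun x => W x ^+ k).
Proof.
move=> Wd; elim: k => [|k IH]; first exact: poly_fun_const.
by rewrite mulSn; apply: poly_fun_ext (poly_funM Wd IH) => x _; rewrite exprS.
Qed.

Lemma poly_fun_prod a (r : seq nat) (D : nat -> nat) (P : pred nat) (W : nat -> seq rat -> rat) :
  (forall i, i \in r -> P i -> poly_fun a (D i) (W i)) ->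
  poly_fun a (\sum_(i <- r | P i) D i) (fun x => \prod_(i <- r | P i) W i x).
Proof.
elim: r => [|i r IH] Wp.
  by apply: poly_fun_ext (poly_fun_const a _ 1) => x _; rewrite big_nil.
have Hr : poly_fun a (\sum_(i <- r | P i) D i) (fun x => \prod_(i <- r | P i) W i x).
  by apply: IH => j jr; apply: Wp; rewrite inE jr orbT.
rewrite big_cons; case: ifP => Pi.
  apply: poly_fun_ext (poly_funM (Wp i (mem_head _ _) Pi) Hr) => x _.
  by rewrite big_cons Pi.
by apply: poly_fun_ext Hr => x _; rewrite big_cons Pi.
Qed.

Lemma poly_fun_comp a b d W (phi : seq rat -> seq rat) :
  (forall x, size x = a -> size (phi x) = b) ->
  (forall i, (i < b)%N -> poly_fun a 1 (fun x => (phi x)`_i)) ->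
  poly_fun b d W -> poly_fun a d (fun x => W (phi x)).
Proof.
move=> sphi phi1 [l bl El].
apply: (@poly_fun_ext _ _ (fun x => \sum_(p <- l) p.1 * monomial p.2 (phi x))).
  by move=> x sx; rewrite El // sphi.
apply: poly_fun_sum => p /(allP bl)/andP[/eqP sp dp] _.
apply: poly_funZ; apply: poly_fun_le dp _.
rewrite sumn_big_nth; apply: poly_fun_prod => i.
rewrite mem_index_iota sp => ib _.
apply: (@poly_fun_le _ (nth 0 p.2 i * 1)); first by rewrite muln1.
by apply: poly_funX; apply: phi1.
Qed.

Lemma poly_fun_horner a d i (p : {poly rat}) :
  (i < a)%N -> (size p <= d.+1)%N -> poly_fun a d (fun x => p.[x`_i]).
Proof.
move=> ia sp.
apply: (@poly_fun_ext _ _ (fun x => \sum_(j <- enum 'I_(size p)) p`_j * x`_i ^+ j)).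
  by move=> x _; rewrite horner_coef big_enum.
apply: poly_fun_sum => j _ _; apply/poly_funZ/(@poly_fun_le _ (j * 1)).
  by rewrite muln1 -ltnS (leq_trans (ltn_ord j)).
exact/poly_funX/poly_fun_coord.
Qed.

Definition poly_nat (d : nat) (g : nat -> rat) : Prop :=
  exists2 p : {poly rat}, (size p <= d.+1)%N & forall m, g m = p.[m%:R].

Lemma poly_natD d g g' :
  poly_nat d g -> poly_nat d g' -> poly_nat d (fun m => g m + g' m).
Proof.
move=> [p sp Ep] [q sq Eq]; exists (p + q); last by move=> m; rewrite hornerD Ep Eq.
by rewrite (leq_trans (size_polyD _ _)) // geq_max sp.
Qed.

Lemma poly_natZ d c g : poly_nat d g -> poly_nat d (fun m => c * g m).
Proof.
move=> [p sp Ep]; exists (c *: p); last by move=> m; rewrite hornerZ Ep.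
exact: leq_trans (size_scale_leq _ _) sp.
Qed.

Lemma poly_nat_mulX d g : poly_nat d g -> poly_nat d.+1 (fun m => m%:R * g m).
Proof.
move=> [p sp Ep]; exists (p * 'X); last by move=> m; rewrite hornerMX Ep mulrC.
by have [->|p0] := eqVneq p 0; rewrite ?mul0r ?size_poly0 // size_mulX.
Qed.

Lemma poly_nat_le d d' g : (d <= d')%N -> poly_nat d g -> poly_nat d' g.
Proof. by move=> dd' [p sp Ep]; exists p => //; apply: leq_trans sp _. Qed.

Lemma poly_nat_exp d : poly_nat d (fun m => m%:R ^+ d).
Proof. by exists ('X^d) => [|m]; rewrite ?size_polyXn // hornerXn. Qed.

Lemma poly_nat_ext d g g' : g =1 g' -> poly_nat d g -> poly_nat d g'.
Proof. by move=> e [p sp Ep]; exists p => // m; rewrite -e. Qed.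

Lemma poly_nat_sum d n (g : nat -> nat -> rat) :
  (forall i, (i < n)%N -> poly_nat d (g i)) ->
  poly_nat d (fun m => \sum_(i < n) g i m).
Proof.
elim: n => [|n IH] gd.
  exists 0; first by rewrite size_poly0.
  by move=> m; rewrite big_ord0 horner0.
have := poly_natD (IH (fun i lt => gd i (ltnW lt))) (gd n (ltnSn n)).
by apply: poly_nat_ext => m; rewrite big_ord_recr.
Qed.

(** Faulhaber: telescoping [(b + 1)^(k + 1) - b^(k + 1)] expresses the sum of
    [k]-th powers through sums of lower powers. *)
Lemma sum_powers_poly k :
  poly_nat k.+1 (fun m => \sum_(0 <= b < m) b%:R ^+ k).
Proof.
elim/ltn_ind: k => k IH.
pose S i m : rat := \sum_(0 <= b < m) b%:R ^+ i.
have E m : S k m = k.+1%:R^-1 *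
    (m%:R ^+ k.+1 + (-1) * \sum_(i < k) 'C(k.+1, i)%:R * S i m).
  have -> : m%:R ^+ k.+1 = \sum_(i < k.+1) 'C(k.+1, i)%:R * S i m.
    transitivity (\sum_(0 <= b < m) (b.+1%:R ^+ k.+1 - b%:R ^+ k.+1 : rat)).
      by rewrite telescope_sumr // expr0n subr0.
    under [RHS]eq_bigr do rewrite mulr_sumr.
    rewrite exchange_big /=; apply: eq_bigr => b _.
    rewrite -addn1 natrD exprD1n big_ord_recr /= binn mulr1n addrK.
    by apply: eq_bigr => i _; rewrite mulr_natl.
  by rewrite big_ord_recr /= mulN1r addrAC subrr add0r binSn mulKf ?pnatr_eq0.
apply: poly_nat_ext (fun m => esym (E m)) _.
apply/poly_natZ/poly_natD; first exact: poly_nat_exp.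
apply/poly_natZ/(@poly_nat_sum _ _ (fun i m => 'C(k.+1, i)%:R * S i m)) => i ik.
apply/poly_natZ.
by apply: poly_nat_le (IH i ik); lia.
Qed.

(** This is what a multiplicity [m] contributes when [k] of its copies are split
    off with weight [k]. *)
Lemma sum_convolution_poly e :
  poly_nat e.+2 (fun m => \sum_(1 <= k < m) k%:R * (m - k)%:R ^+ e).
Proof.
have E m : \sum_(1 <= k < m) k%:R * (m - k)%:R ^+ e =
   (m%:R * (\sum_(0 <= b < m) b%:R ^+ e + (-1) * 0 ^+ e)
    + (-1) * \sum_(0 <= b < m) b%:R ^+ e.+1 : rat).
  rewrite big_nat_rev /=.
  have -> : \sum_(1 <= i < m) (1 + m - i.+1)%:R * (m - (1 + m - i.+1))%:R ^+ e
    = \sum_(1 <= i < m) (m%:R * i%:R ^+ e - i%:R ^+ e.+1) :> rat.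
    rewrite big_nat [RHS]big_nat; apply: eq_bigr => i /andP[i1 im].
    by rewrite add1n subSS subKn 1?ltnW // natrB 1?ltnW // exprS mulrBl.
  rewrite sumrB -mulr_sumr; case: m => [|m].
    by rewrite !big_geq // mul0r; ring.
  have L (f : nat -> rat) :
      \sum_(0 <= b < m.+1) f b = f 0%N + \sum_(1 <= b < m.+1) f b.
    by rewrite big_ltn.
  rewrite !L exprS mul0r.
  ring.
apply: poly_nat_ext (fun m => esym (E m)) _.
apply: poly_natD; last exact/poly_natZ/sum_powers_poly.
apply: poly_nat_mulX; apply: poly_natD; first exact: sum_powers_poly.
apply/poly_natZ; exists (0 ^+ e)%:P; last by move=> m; rewrite hornerC.
by rewrite (leq_trans (size_polyC_leq1 _)).
Qed.

(** * The span of the MacMahonesque functions *)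

Definition mac_span (d : nat) (f : nat -> rat) : Prop :=
  exists2 l : seq (rat * seq nat),
    all (fun p => (0 < size p.2) && (sumn p.2 <= d))%N l &
    forall n, f n = \sum_(p <- l) p.1 * (macmahon p.2 n)%:R.

Lemma mac_span_ext d f g : f =1 g -> mac_span d f -> mac_span d g.
Proof. by move=> e [l bl El]; exists l => // n; rewrite -e. Qed.

Lemma mac_span_le d d' f : (d <= d')%N -> mac_span d f -> mac_span d' f.
Proof.
move=> dd' [l bl El]; exists l => //; apply: sub_all bl => p /andP[-> pd] /=.
exact: leq_trans dd'.
Qed.

Lemma mac_spanD d f g :
  mac_span d f -> mac_span d g -> mac_span d (fun n => f n + g n).
Proof.
move=> [l bl El] [l' bl' El']; exists (l ++ l'); first by rewrite all_cat bl.
by move=> n; rewrite big_cat El El'.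
Qed.

Lemma mac_spanZ d c f : mac_span d f -> mac_span d (fun n => c * f n).
Proof.
move=> [l bl El]; exists [seq (c * p.1, p.2) | p <- l]; first by rewrite all_map.
move=> n; rewrite big_map El mulr_sumr.
by apply: eq_bigr => p _ /=; rewrite mulrA.
Qed.

Lemma mac_spanB d f g :
  mac_span d f -> mac_span d g -> mac_span d (fun n => f n - g n).
Proof.
move=> fd gd; apply: mac_span_ext (mac_spanD fd (mac_spanZ (-1) gd)) => n.
by rewrite mulN1r.
Qed.

Lemma mac_span_sum d (I : eqType) (r : seq I) (f : I -> nat -> rat) :
  (forall i, i \in r -> mac_span d (f i)) ->
  mac_span d (fun n => \sum_(i <- r) f i n).
Proof.
elim: r => [|i r IH] fd.
  by exists [::] => // n; rewrite !big_nil.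
have Hr : mac_span d (fun n => \sum_(i <- r) f i n).
  by apply: IH => j jr; apply: fd; rewrite inE jr orbT.
apply: mac_span_ext (mac_spanD (fd i (mem_head _ _)) Hr) => n.
by rewrite big_cons.
Qed.

Definition rseq (xs : seq nat) : seq rat := [seq x%:R | x <- xs].

(** The coefficient of [q^n] in the generating series of partitions with [a]
    distinct parts, weighted by [W]. *)
Definition part_sum (a : nat) (W : seq (nat * nat) -> rat) (n : nat) : rat :=
  psum part_rel n.+1 a (n.+1, 0%N) (fun L => W L * (area L == n)%:R).

Lemma eq_part_sum a W W' n :
  (forall L, size L = a -> all (fun p => 0 < p.2)%N L -> area L = n -> W L = W' L) ->
  part_sum a W n = part_sum a W' n.
Proof.
move=> eW; apply: eq_psum => L sL pL.
have [aL|] := eqVneq (area L) n; last by rewrite !mulr0.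
congr (_ * _); apply: eW => //.
elim: L (n.+1, 0%N) pL {sL aL} => [|y L IH] x //= /andP[/andP[_ ->]].
exact: IH.
Qed.

Lemma part_sumD a W W' n :
  part_sum a (fun L => W L + W' L) n = part_sum a W n + part_sum a W' n.
Proof.
by rewrite /part_sum -psumD; apply: eq_psum => L _ _; rewrite mulrDl.
Qed.

Lemma part_sumZ a c W n : part_sum a (fun L => c * W L) n = c * part_sum a W n.
Proof.
by rewrite /part_sum -psumZ; apply: eq_psum => L _ _; rewrite mulrA.
Qed.

Lemma part_sum_sum a (I : Type) (r : seq I) (W : I -> seq (nat * nat) -> rat) n :
  part_sum a (fun L => \sum_(i <- r) W i L) n = \sum_(i <- r) part_sum a (W i) n.
Proof.
by rewrite /part_sum -psum_sum; apply: eq_psum => L _ _; rewrite mulr_suml.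
Qed.

(** The lists of a partition run through the parts decreasingly, whereas the
    exponents of [macmahon v] are attached to increasing parts; hence [rev v]. *)
Lemma macmahonE v n :
  (macmahon v n)%:R =
  part_sum (size v) (fun L => monomial (rev v) (rseq (unzip2 L))) n :> rat.
Proof.
set a := size v; pose T := {ffun 'I_a -> 'I_n.+1}.
pose Lof (p : T * T) :=
  [seq (val (p.1 (rev_ord i)), val (p.2 (rev_ord i))) | i <- enum 'I_a].
have sLof p : size (Lof p) = a by rewrite size_map size_enum_ord.
have nthLof p i (ia : (i < a)%N) : nth (0, 0)%N (Lof p) i =
    (val (p.1 (rev_ord (Ordinal ia))), val (p.2 (rev_ord (Ordinal ia)))).
  rewrite (nth_map (Ordinal ia)) ?size_enum_ord //.
  by have -> : nth (Ordinal ia) (enum 'I_a) i = Ordinal ia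
    by apply: val_inj; rewrite /= nth_enum_ord.
rewrite /part_sum psum_tuple big_mkcond.
pose h (p : T * T) : a.-tuple ('I_n.+1 * 'I_n.+1) :=
  [tuple (p.1 (rev_ord i), p.2 (rev_ord i)) | i < a].
have hE p : [seq (val q.1, val q.2) | q <- h p] = Lof p.
  by rewrite /= -map_comp; apply: eq_map.
rewrite (reindex h) /=; last first.
  exists (fun t => ([ffun i => (tnth t (rev_ord i)).1], [ffun i => (tnth t (rev_ord i)).2])).
    by move=> [s m] _; congr pair; apply/ffunP => i; rewrite ffunE tnth_mktuple rev_ordK.
  move=> t _; apply: eq_from_tnth => i; rewrite tnth_mktuple /= !ffunE rev_ordK.
  by case: (tnth t i).
rewrite -big_mkcond /= /macmahon natr_sum.
under eq_bigr do rewrite natr_sum.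
rewrite pair_big_dep /= [RHS]big_mkcond [LHS]big_mkcond; apply: eq_bigr => p _.
rewrite hE.
have areaE : area (Lof p) = (\sum_(i < a) p.2 i * p.1 i)%N.
  rewrite /area big_map big_enum /= (reindex_inj rev_ord_inj) /=.
  by apply: eq_bigr => i _; rewrite rev_ordK mulnC.
have monE : monomial (rev v) (rseq (unzip2 (Lof p))) =
    (\prod_(i < a) p.2 i ^ nth 0 v i)%N%:R.
  rewrite /monomial size_rev -/a big_mkord natr_prod (reindex_inj rev_ord_inj) /=.
  apply: eq_bigr => i _; rewrite natrX; congr (_ ^+ _).
    rewrite (nth_map 0%N); last by rewrite size_map sLof; apply: (ltn_ord (rev_ord i)).
    rewrite (nth_map (0, 0)%N) ?sLof ?(ltn_ord (rev_ord i)) //.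
    rewrite (nthLof p _ (ltn_ord (rev_ord i))) /=; congr (_%:R).
    by congr (val (p.2 _)); apply: val_inj; rewrite /= -subSn // subKn // ltnW.
  rewrite nth_rev ?(ltn_ord (rev_ord i)) // -/a; congr nth.
  by rewrite /= -subSn // subSS subKn // ltnW.
rewrite areaE monE.
have -> : path part_rel (n.+1, 0%N) (Lof p) =
  [&& [forall i : 'I_a, 0 < p.1 i], [forall i : 'I_a, forall j : 'I_a, (i < j) ==> (p.1 i < p.1 j)]
    & [forall i : 'I_a, 0 < p.2 i]]%N.
  rewrite -[path _ _ _]/(sorted part_rel (_ :: _)) sorted_pairwise /=; last first.
    by move=> y x z; rewrite /part_rel; lia.
  apply/andP/and3P => [[/allP hA /(pairwiseP (0, 0)%N) hP]|[/forallP h1 /forallP h2 /forallP h3]].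
    have hA' i : part_rel (n.+1, 0%N) (val (p.1 i), val (p.2 i)).
      apply: hA; apply/mapP; exists (rev_ord i); rewrite ?mem_enum //.
      by rewrite rev_ordK.
    split; first by apply/forallP => i; case/andP: (hA' i) => /andP[].
      apply/forallP => i; apply/forallP => j; apply/implyP => ij.
      have rji : (rev_ord j < rev_ord i)%N.
        by rewrite /= ltn_sub2l // (leq_ltn_trans ij (ltn_ord j)).
      have := hP (rev_ord j) (rev_ord i).
      rewrite !inE !sLof => /(_ (ltn_ord _) (ltn_ord _) rji).
      rewrite (nthLof _ _ (ltn_ord (rev_ord j))) (nthLof _ _ (ltn_ord (rev_ord i))).
      have Er k : Ordinal (ltn_ord (rev_ord k)) = rev_ord k :> 'I_a by apply: val_inj.
      by rewrite !Er !rev_ordK => /andP[/andP[]].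
    by apply/forallP => i; case/andP: (hA' i).
  split.
    apply/allP => _ /mapP[i _ ->].
    by rewrite /part_rel /= h1 h3 ltn_ord.
  apply/(pairwiseP (0, 0)%N) => i j; rewrite !inE !sLof => ia ja ij.
  rewrite (nthLof _ _ ia) (nthLof _ _ ja) /part_rel /= h1 h3 andbT /=.
  have /forallP/(_ (rev_ord (Ordinal ia)))/implyP := h2 (rev_ord (Ordinal ja)).
  by apply; rewrite /= ltn_sub2l // (leq_ltn_trans ij ja).
rewrite [X in if X then _ else _]andbA andbA -andbA.
rewrite (eq_sym n).
by case: eqP => _; rewrite ?andbF ?andbT ?mulr1 ?mulr0 ?if_same // -?andbA.
Qed.

(** * Multiplication by n *)

(** Expanding a polynomial weight in the multiplicities into monomials. *)
Lemma mac_span_part_sum a d W : (0 < a)%N -> poly_fun a d W ->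
  mac_span d (part_sum a (fun L => W (rseq (unzip2 L)))).
Proof.
move=> a0 [l bl El]; exists [seq (p.1, rev p.2) | p <- l].
  rewrite all_map; apply: sub_all bl => p /andP[/eqP sp dp] /=.
  by rewrite size_rev sp a0 sumn_rev.
move=> n; rewrite big_map /=.
transitivity (\sum_(p <- l)
    part_sum a (fun L => p.1 * monomial p.2 (rseq (unzip2 L))) n).
  by rewrite -part_sum_sum; apply: eq_part_sum => L sL _ _; rewrite El // !size_map.
rewrite big_seq [RHS]big_seq; apply: eq_bigr => p /(allP bl)/andP[/eqP sp _].
by rewrite macmahonE part_sumZ size_rev revK sp.
Qed.

Lemma rseq_cumsum x xs : rseq (cumsum x xs) = cumsum x%:R (rseq xs).
Proof. by elim: xs x => [|y ys IH] x //=; rewrite IH natrD. Qed.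

Lemma size_cumsum (V : nmodType) (x : V) xs : size (cumsum x xs) = size xs.
Proof. by elim: xs x => [|y ys IH] x //=; rewrite IH. Qed.

Lemma nth_cumsum (x : rat) xs i : (i < size xs)%N ->
  (cumsum x xs)`_i = x + \sum_(0 <= j < i.+1) xs`_j.
Proof.
elim: xs x i => [|y ys IH] x [|i] //= si; first by rewrite big_nat1.
by rewrite IH // [in RHS]big_nat_recl //= addrA.
Qed.

Fixpoint differences (x : rat) (xs : seq rat) : seq rat :=
  if xs is y :: ys then (y - x) :: differences y ys else [::].

Lemma cumsumK x xs : differences x (cumsum x xs) = xs.
Proof. by elim: xs x => [|y ys IH] x //=; rewrite IH addrAC subrr add0r. Qed.

Lemma size_differences x xs : size (differences x xs) = size xs.
Proof. by elim: xs x => [|y ys IH] x //=; rewrite IH. Qed.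

Lemma nth_differences x xs i : (i < size xs)%N ->
  (differences x xs)`_i = xs`_i - (x :: xs)`_i.
Proof. by elim: xs x i => [|y ys IH] x [|i] //= si; rewrite IH. Qed.

Lemma poly_fun_rev_cumsum a d W : poly_fun a d W ->
  poly_fun a d (fun x => W (rev (cumsum 0 x))).
Proof.
apply: poly_fun_comp => [x sx|i ia]; first by rewrite size_rev size_cumsum.
apply: (@poly_fun_ext _ _ (fun x => \sum_(j <- index_iota 0 (a - i.+1).+1) x`_j)).
  by move=> x sx; rewrite nth_rev size_cumsum sx // nth_cumsum ?add0r ?sx //; lia.
by apply: poly_fun_sum => j; rewrite mem_index_iota => jr _; apply: poly_fun_coord; lia.
Qed.

(** The inverse of the substitution [poly_fun_rev_cumsum]. *)
Lemma poly_fun_differences_rev a d W : poly_fun a d W ->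
  poly_fun a d (fun x => W (differences 0 (rev x))).
Proof.
apply: poly_fun_comp => [x sx|i ia]; first by rewrite size_differences size_rev.
case: i ia => [|i] ia.
  apply: (@poly_fun_ext _ _ (fun x => x`_(a - 1))).
    by move=> x sx; rewrite nth_differences ?size_rev ?sx // nth_rev sx //= subr0.
  by apply: poly_fun_coord; lia.
apply: (@poly_fun_ext _ _ (fun x => x`_(a - i.+2) + (-1) * x`_(a - i.+1))).
  move=> x sx; rewrite nth_differences ?size_rev ?sx //= !nth_rev sx //; last by lia.
  by rewrite mulN1r.
apply: poly_funD; last apply: poly_funZ; apply: poly_fun_coord; lia.
Qed.

(** Conjugation permutes the partitions of [n] with [a] distinct parts, and the
    substitution it induces is linear, so it keeps the degree of a weight. *)
Lemma part_sum_conj a W n :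
  part_sum a (fun L => W (rseq (unzip1 L))) n =
  part_sum a (fun L => W (rev (cumsum 0 (rseq (unzip2 L))))) n.
Proof.
rewrite /part_sum.
rewrite (@psum_weight_conj _ _ (fun x => W (rseq x)) (fun k => (k == n)%:R)).
  apply: eq_psum => L _ _; congr (W _ * _).
  by rewrite /rseq map_rev -/(rseq _) rseq_cumsum.
by move=> k nk; case: eqP => // kn; lia.
Qed.

Lemma mac_span_part_sum_parts a d W : (0 < a)%N -> poly_fun a d W ->
  mac_span d (part_sum a (fun L => W (rseq (unzip1 L)))).
Proof.
move=> a0 /poly_fun_rev_cumsum /(mac_span_part_sum a0).
by apply: mac_span_ext => n; rewrite part_sum_conj.
Qed.

(** The stuffle product graded by the area. *)
Lemma stuffle_area a (h : nat * nat -> rat) (w : seq (nat * nat) -> rat) n :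
  \sum_(0 <= s < n.+1 | (0 < s < n.+1)%N) \sum_(0 <= m < n.+1 | (0 < m)%N)
     psum part_rel n.+1 a (n.+1, 0%N)
       (fun L => h (s, m) * w L * (s * m + area L == n)%N%:R) =
  part_sum a.+1 (fun L => \sum_(0 <= i < a.+1)
     h (nth (0, 0)%N L i) * w (take i L ++ drop i.+1 L)) n +
  part_sum a (fun L => \sum_(0 <= i < a)
     \sum_(1 <= k < (nth (0, 0)%N L i).2)
       h ((nth (0, 0)%N L i).1, k) *
       w (take i L ++ ((nth (0, 0)%N L i).1, (nth (0, 0)%N L i).2 - k)%N :: drop i.+1 L)) n.
Proof.
pose F p L := h p * w L * (p.1 * p.2 + area L == n)%N%:R.
rewrite (@stuffle n.+1 a (n.+1, 0%N) F) //; last first.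
  move=> s k m L1 L2 s0 nkm; rewrite /F area_cat area_cons /=.
  have h1 : (k + m <= s * (k + m))%N by apply: leq_pmull.
  case: eqP => [e|]; last by rewrite mulr0.
  by move: h1; rewrite mulnDr => h1; lia.
have areaE L i : (i < size L)%N ->
    area L = ((nth (0, 0)%N L i).1 * (nth (0, 0)%N L i).2
              + area (take i L ++ drop i.+1 L))%N.
  move=> iL; rewrite -{1}(cat_take_drop i L) (drop_nth (0, 0)%N iL).
  by rewrite !area_cat area_cons addnCA.
congr +%R; apply: eq_psum => L sL _.
  rewrite /ins_sum sL mulr_suml big_nat [RHS]big_nat; apply: eq_bigr => i /andP[_ ia].
  by rewrite /F -areaE // sL.
rewrite /mrg_sum sL mulr_suml big_nat [RHS]big_nat; apply: eq_bigr => i /andP[_ ia].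
rewrite mulr_suml big_nat [RHS]big_nat; apply: eq_bigr => k /andP[_ km].
rewrite /F (areaE L i) ?sL // !area_cat area_cons /=.
congr (_ * (_ == _)%:R); rewrite mulnBr.
have := leq_mul (leqnn (nth (0, 0)%N L i).1) (ltnW km); lia.
Qed.

Lemma poly_fun_remove a d W : poly_fun a d W -> forall i, (i < a.+1)%N ->
  poly_fun a.+1 d (fun x => W (take i x ++ drop i.+1 x)).
Proof.
move=> Wp i ia; apply: poly_fun_comp Wp => [x sx|j ja].
  by rewrite size_cat size_takel ?size_drop sx //; lia.
apply: (@poly_fun_ext _ _ (fun x => x`_(bump i j))).
  move=> x sx; rewrite nth_cat size_takel ?sx // /bump; last by lia.
  case: ltnP => ji; first by rewrite nth_take.
  by rewrite nth_drop; congr nth; lia.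
by apply: poly_fun_coord; rewrite /bump; lia.
Qed.

(** The convolution of sigma_1 with [part_sum a W]: a divisor [m] of [s * m]
    carries weight [m]. *)
Definition sigma_product (a : nat) (W : seq rat -> rat) (n : nat) : rat :=
  \sum_(0 <= s < n.+1 | (0 < s < n.+1)%N) \sum_(0 <= m < n.+1 | (0 < m)%N)
     psum part_rel n.+1 a (n.+1, 0%N)
       (fun L => m%:R * W (rseq (unzip2 L)) * (s * m + area L == n)%N%:R).

(** First evaluation: insertion raises the degree by one and the number of parts
    by one; merging raises the degree by two. *)
Lemma mac_span_sigma_product v : (0 < size v)%N ->
  mac_span (sumn v).+2 (sigma_product (size v) (monomial v)).
Proof.
set a := size v => a0.
apply: mac_span_ext (fun n => esym (stuffle_area a (fun p => p.2%:R)
  (fun L => monomial v (rseq (unzip2 L))) n)) _.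
apply: mac_spanD.
  pose W (x : seq rat) := \sum_(i <- index_iota 0 a.+1)
    x`_i * monomial v (take i x ++ drop i.+1 x).
  have Wp : poly_fun a.+1 (sumn v).+1 W.
    apply: poly_fun_sum => i; rewrite mem_index_iota => /= ia _.
    apply: (@poly_funM _ 1 (sumn v)); first exact: poly_fun_coord.
    exact: poly_fun_remove (poly_fun_monomial (leqnn _)) _ ia.
  apply: mac_span_le (mac_span_ext _ (mac_span_part_sum (ltn0Sn a) Wp)) => //.
  move=> n; apply: eq_part_sum => L sL _ _.
  rewrite /W big_nat [RHS]big_nat; apply: eq_bigr => i /andP[_ ia].
  rewrite (nth_map 0%N) ?size_map ?sL // (nth_map (0, 0)%N) ?sL //.
  by rewrite /rseq /unzip2 !map_cat !map_take !map_drop.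
apply: mac_span_ext (fun n => esym (part_sum_sum _ _ _ _)) _.
apply: mac_span_sum => i; rewrite mem_index_iota => /= ia.
(* Only the i-th factor of the monomial is affected by the merging. *)
have [q sq Eq] := sum_convolution_poly (nth 0%N v i).
pose W (x : seq rat) := q.[x`_i] * \prod_(j <- index_iota 0 a | j != i) x`_j ^+ nth 0%N v j.
have Wp : poly_fun a (sumn v).+2 W.
  have -> : (sumn v).+2 = ((nth 0 v i).+2 + \sum_(j <- index_iota 0 a | j != i) nth 0 v j * 1)%N.
    rewrite sumn_big_nth -/a (bigD1_seq i) ?iota_uniq ?mem_iota ?subn0 //= addSn addSn.
    by do 2!congr _.+1; congr addn; apply: eq_bigr => j _; rewrite muln1.
  apply: poly_funM; first exact: poly_fun_horner.
  apply: poly_fun_prod => j; rewrite mem_index_iota => /= ja _.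
  exact/poly_funX/poly_fun_coord.
apply: mac_span_ext (mac_span_part_sum a0 Wp) => n.
apply: eq_part_sum => L sL _ _.
have iL : (i < size L)%N by rewrite sL.
rewrite /W (nth_map 0%N) ?size_map // (nth_map (0, 0)%N) // -Eq mulr_suml.
apply: eq_bigr => k _; rewrite -mulrA; congr (_ * _).
rewrite /monomial -/a [RHS](bigD1_seq i) ?iota_uniq ?mem_iota ?subn0 //=.
have nthE j : (rseq (unzip2 (take i L ++ ((nth (0, 0)%N L i).1, (nth (0, 0)%N L i).2 - k)%N :: drop i.+1 L)))`_j
   = if j == i then ((nth (0, 0)%N L i).2 - k)%N%:R else (rseq (unzip2 L))`_j.
  rewrite /rseq /unzip2 -!map_comp map_cat map_take /= map_drop.
  rewrite nth_cat size_takel; last by rewrite size_map ltnW.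
  case: (ltngtP j i) => ji; first by rewrite nth_take.
    have [t ->] : exists t, j = (i + t.+1)%N by exists (j - i.+1)%N; lia.
    by rewrite addKn /= nth_drop addSnnS.
  by rewrite ji subnn.
rewrite nthE eqxx; congr (_ * _).
by apply: eq_bigr => j /negPf ji; rewrite nthE ji.
Qed.

(** Second evaluation: after conjugation the weight [G] is constant under
    merging, so the number [m_i - 1] of ways to split [m_i] becomes a factor, and
    [sum_i m_i s_i = n] produces the factor [n]. *)
Lemma sigma_product_conj a (G : seq rat -> rat) n :
  sigma_product a (fun x => G (rev (cumsum 0 x))) n =
  part_sum a.+1 (fun L =>
      \sum_(0 <= i < a.+1) (rseq (unzip1 L))`_i *
        G (take i (rseq (unzip1 L)) ++ drop i.+1 (rseq (unzip1 L)))) n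
  + (n%:R * part_sum a (fun L => G (rseq (unzip1 L))) n
     - part_sum a (fun L => (\sum_(0 <= i < a) (rseq (unzip1 L))`_i)
          * G (rseq (unzip1 L))) n).
Proof.
transitivity (\sum_(0 <= s < n.+1 | (0 < s < n.+1)%N) \sum_(0 <= m < n.+1 | (0 < m)%N)
   psum part_rel n.+1 a (n.+1, 0%N)
     (fun L => s%:R * G (rseq (unzip1 L)) * (s * m + area L == n)%N%:R)).
  have cond (f : nat -> rat) : \sum_(0 <= s < n.+1 | (0 < s < n.+1)%N) f s =
      \sum_(0 <= s < n.+1 | (0 < s)%N) f s.
    by rewrite big_nat_cond [RHS]big_nat_cond; apply: eq_bigl => s; lia.
  rewrite /sigma_product !cond exchange_big_nat /=.
  apply: eq_bigr => m m0; apply: eq_bigr => s s0.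
  transitivity (m%:R * psum part_rel n.+1 a (n.+1, 0%N)
     (fun L => G (rev (cumsum 0 (rseq (unzip2 L)))) * (s * m + area L == n)%N%:R)).
    by rewrite -psumZ; apply: eq_psum => L _ _; rewrite mulrA.
  transitivity (m%:R * psum part_rel n.+1 a (n.+1, 0%N)
     (fun L => G (rseq (unzip1 L)) * (s * m + area L == n)%N%:R)).
    rewrite (@psum_weight_conj _ _ (fun x => G (rseq x)) (fun k => (s * m + k == n)%N%:R)).
      congr (_ * _); apply: eq_psum => L _ _; congr (G _ * _).
      by rewrite [RHS]/rseq map_rev -/(rseq (cumsum _ _)) rseq_cumsum.
    by move=> k nk; case: eqP => // kn; lia.
  by rewrite -psumZ; apply: eq_psum => L _ _; rewrite mulrA (mulnC s).
rewrite (stuffle_area a (fun p => p.1%:R) (fun L => G (rseq (unzip1 L)))).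
congr +%R.
  apply: eq_part_sum => L sL _ _.
  rewrite big_nat [RHS]big_nat; apply: eq_bigr => i /andP[_ ia].
  rewrite (nth_map 0%N) ?size_map ?sL // (nth_map (0, 0)%N) ?sL //.
  by rewrite /rseq /unzip1 !map_cat !map_take !map_drop.
rewrite -part_sumZ -mulN1r -part_sumZ -part_sumD.
apply: eq_part_sum => L sL pos aL.
rewrite mulrA -mulrDl -aL /area.
rewrite (big_nth (0, 0)%N) sL natr_sum mulN1r -sumrB mulr_suml.
rewrite big_nat [RHS]big_nat; apply: eq_bigr => i /andP[_ ia].
rewrite (nth_map 0%N) ?size_map ?sL // (nth_map (0, 0)%N) ?sL //.
(* Positivity matters: [m_i - 1] is a truncated difference. *)
have mi : (0 < (nth (0, 0)%N L i).2)%N by apply: (allP pos); rewrite mem_nth ?sL.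
rewrite (eq_big_nat _ _ (F2 := fun=> (nth (0, 0)%N L i).1%:R * G (rseq (unzip1 L)))).
  rewrite sumr_const_nat -[LHS]mulr_natl natrB // natrM; ring.
move=> k /andP[_ km]; congr (_ * G (rseq _)).
rewrite -[in RHS](cat_take_drop i L) [drop i L](drop_nth (0, 0)%N) ?sL //.
by rewrite /unzip1 !map_cat.
Qed.

(** Solving the equality of the two evaluations for the term with factor [n]. *)
Lemma mac_span_mul_nat_part_sum v : (0 < size v)%N ->
  mac_span (sumn v).+2
    (fun n => n%:R * part_sum (size v) (fun L => monomial v (rseq (unzip2 L))) n).
Proof.
set a := size v => a0.
(* The weight in the part sizes that conjugation turns into [monomial v]. *)
pose G (x : seq rat) := monomial v (differences 0 (rev x)).
have Gp : poly_fun a (sumn v) G.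
  exact/poly_fun_differences_rev/poly_fun_monomial.
have mon_conj x : G (rev (cumsum 0 x)) = monomial v x.
  by rewrite /G revK cumsumK.
pose W (x : seq rat) := \sum_(i <- index_iota 0 a.+1)
   x`_i * G (take i x ++ drop i.+1 x).
have Wp : poly_fun a.+1 (sumn v).+1 W.
  apply: poly_fun_sum => i; rewrite mem_index_iota => /= ia _.
  by apply: (@poly_funM _ 1 (sumn v)); [exact: poly_fun_coord | exact: poly_fun_remove].
pose W' (x : seq rat) := (\sum_(i <- index_iota 0 a) x`_i) * G x.
have Wp' : poly_fun a (sumn v).+1 W'.
  apply: (@poly_funM _ 1 (sumn v)) => //.
  by apply: poly_fun_sum => i; rewrite mem_index_iota => /= ia _; exact: poly_fun_coord.
have s1 := mac_span_le (leqnSn _) (mac_span_part_sum_parts (ltn0Sn a) Wp).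
have s2 := mac_span_le (leqnSn _) (mac_span_part_sum_parts a0 Wp').
apply: mac_span_ext (mac_spanD (mac_spanB (mac_span_sigma_product a0) s1) s2) => n.
have -> : sigma_product (size v) (monomial v) n =
    sigma_product a (fun x => G (rev (cumsum 0 x))) n.
  apply: eq_bigr => s _; apply: eq_bigr => m _; apply: eq_psum => L _ _.
  by rewrite mon_conj.
rewrite sigma_product_conj part_sum_conj.
rewrite (@eq_part_sum a (fun L => G _) (fun L => monomial v (rseq (unzip2 L)))).
  by rewrite /W /W'; ring.
by move=> L _ _ _; rewrite mon_conj.
Qed.

(** The derivation [q d/dq] of generating series maps the span into itself and
    raises the degree by at most two. *)
Lemma mac_span_mul_nat d f :
  mac_span d f -> mac_span d.+2 (fun n => n%:R * f n).
Proof.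
move=> [l bl El].
apply: (@mac_span_ext _ (fun n => \sum_(p <- l) p.1 * (n%:R * (macmahon p.2 n)%:R))).
  by move=> n; rewrite El mulr_sumr; apply: eq_bigr => p _; rewrite mulrCA.
apply: mac_span_sum => p /(allP bl)/andP[sp dp]; apply: mac_spanZ.
have := @mac_span_mul_nat_part_sum (rev p.2); rewrite size_rev sumn_rev => /(_ sp).
move=> /(@mac_span_le _ d.+2); rewrite !ltnS => /(_ dp).
by apply: mac_span_ext => n; rewrite macmahonE.
Qed.

Lemma mac_span_exp d f j :
  mac_span d f -> mac_span (d + j.*2) (fun n => n%:R ^+ j * f n).
Proof.
move=> fd; elim: j => [|j IH].
  by rewrite addn0; apply: mac_span_ext fd => n; rewrite mul1r.
rewrite doubleS !addnS; apply: mac_span_ext (mac_span_mul_nat IH) => n.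
by rewrite exprS mulrA.
Qed.

(** * Prime-detecting functions *)

Lemma common_denominator (s : seq rat) :
  exists2 D : nat, (0 < D)%N & forall x, x \in s -> x * D%:R \is a Num.int.
Proof.
elim: s => [|x s [D D0 HD]]; first by exists 1%N.
exists (`|denq x| * D)%N; first by rewrite muln_gt0 absz_gt0 denq_neq0.
have xint : x * `|denq x|%N%:R \is a Num.int.
  by rewrite -{1}(divq_num_den x) natr_absz normr_denq divfK ?intr_eq0 ?denq_neq0 // intr_int.
move=> y; rewrite inE => /orP[/eqP->|/HD yint]; rewrite natrM.
  by rewrite mulrA rpredM // natr_int.
by rewrite mulrCA rpredM // natr_int.
Qed.

Lemma big_finsupp (T : Type) (idx : T) (op : Monoid.com_law idx)
    (c : coeffs) (S : seq (seq nat)) (F : seq nat -> T) :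
  uniq S -> (forall v, v \notin S -> c v = 0) -> (forall v, c v = 0 -> F v = idx) ->
  \big[op/idx]_(v <- finsupp c) F v = \big[op/idx]_(v <- S) F v.
Proof.
move=> uS cS F0; rewrite [RHS](bigID (fun v => c v == 0)) /= [X in _ = op X _]big1.
  rewrite Monoid.mul1m -[RHS]big_filter; apply: perm_big; apply: uniq_perm.
  - exact: fset_uniq.
  - exact: filter_uniq.
  move=> v; rewrite mem_filter mem_finsupp.
  by have [//|cv] := eqVneq (c v) 0; apply/esym/contraT => /cS /eqP; rewrite (negPf cv).
by move=> v /eqP; apply: F0.
Qed.

(** Clear denominators, then divide by the greatest common divisor, which is
    nonzero because [f] is. *)
Lemma mac_span_coprime_expression d f n0 :
  mac_span d f -> f n0 != 0 ->
  exists (c : coeffs) (lam : rat),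
    [/\ 0 < lam, coeffs_bounded d c, coeffs_gcd c = 1%N
      & forall n, (expression c n)%:~R = lam * f n].
Proof.
move=> [l bl El] fn0.
pose S := undup [seq p.2 | p <- l].
have uS : uniq S by apply: undup_uniq.
pose f0 v := \sum_(p <- l | p.2 == v) p.1.
have fE n : f n = \sum_(v <- S) f0 v * (macmahon v n)%:R.
  under eq_bigr do rewrite mulr_suml.
  rewrite (exchange_big_dep xpredT) //= El big_seq [RHS]big_seq; apply: eq_bigr => p pl.
  have pS : p.2 \in S by rewrite mem_undup map_f.
  rewrite big_mkcond (bigD1_seq p.2) //= eqxx big1 ?addr0 // => v /negPf.
  by rewrite eq_sym => ->.
have [D D0 HD] := common_denominator [seq f0 v | v <- S].
pose e v := Num.floor (f0 v * D%:R).
have eE v : v \in S -> (e v)%:~R = f0 v * D%:R.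
  by move=> vS; rewrite floorK // HD // map_f.
pose g := (\big[gcdn/0]_(v <- S) `|e v|)%N.
have ge v : v \in S -> (g %| `|e v|)%N.
  by move=> vS; rewrite /g (big_rem v) //= dvdn_gcdl.
have g0 : (0 < g)%N.
  rewrite lt0n; apply: contraNN fn0 => /eqP gz.
  rewrite fE big_seq big1 // => v vS.
  have := ge v vS; rewrite gz dvd0n absz_eq0 => /eqP ev.
  have /eqP := eE v vS; rewrite ev eq_sym mulf_eq0 pnatr_eq0 (gtn_eqF D0) orbF.
  by move=> /eqP ->; rewrite mul0r.
pose c : coeffs := [fsfun v in [fset v | v in S]%fset => (e v %/ g%:Z)%Z].
have cE v : c v = if v \in S then (e v %/ g%:Z)%Z else 0.
  by rewrite fsfunE in_fset /=.
have cg v : v \in S -> e v = c v * g%:Z.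
  by move=> vS; rewrite cE vS divzK // dvdzE /= ge.
have cS v : v \notin S -> c v = 0 by rewrite cE => /negPf->.
exists c, (D%:R / g%:R); split.
- by rewrite divr_gt0 // ltr0n.
- move=> v; rewrite cE; case: ifP => // + _; rewrite mem_undup => /mapP[p pl ->].
  by have /andP[] := allP bl p pl.
- rewrite /coeffs_gcd (big_finsupp _ uS cS) => [|v ->] //.
  apply/eqP; rewrite -(eqn_pmul2r g0) mul1n; apply/eqP.
  rewrite {2}/g (big_morph (muln^~ g) (fun x y => muln_gcdl x y g) (mul0n g)).
  by rewrite [LHS]big_seq [RHS]big_seq; apply: eq_bigr => v vS; rewrite (cg v vS) abszM.
move=> n; rewrite /expression (big_finsupp _ uS cS) => [|v ->]; last by rewrite mul0r.
rewrite fE mulr_sumr rmorph_sum /= big_seq [RHS]big_seq; apply: eq_bigr => v vS.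
rewrite intrM mulrA; congr (_ * _).
apply: (mulIf (x := g%:R)); first by rewrite pnatr_eq0 -lt0n.
rewrite mulrAC divfK ?pnatr_eq0 -?lt0n // mulrC [RHS]mulrC -eE // (cg v vS).
by rewrite intrM mulrC.
Qed.

Definition sigma (k n : nat) : rat := \sum_(1 <= t < n.+1 | (t %| n)%N) t%:R ^+ k.

(** A partition with one distinct part is a factorisation [n = s * m]. *)
Lemma mac_span_sigma k : mac_span k (sigma k).
Proof.
have := @mac_span_part_sum 1 k (monomial [:: k]) isT.
have pk : poly_fun 1 k (monomial [:: k]).
  by apply: (@poly_fun_monomial k [:: k]); rewrite /= addn0.
move=> /(_ pk); apply: mac_span_ext => n.
rewrite /part_sum psum_partS exchange_big_nat /=.
rewrite /sigma [RHS](big_nat_widenl _ 0) // [RHS]big_nat_cond [RHS]big_mkcond.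
rewrite [LHS]big_nat_cond [LHS]big_mkcond /=.
apply: eq_bigr => m _; have [/andP[mn m0]|] := boolP ((m < n.+1) && (0 < m))%N; last first.
  by rewrite negb_and => /orP[]/negPf-> //; rewrite !andbF.
rewrite mn m0 andbT /=.
transitivity (m%:R ^+ k * \sum_(0 <= s < n.+1 | (0 < s < n.+1)%N) (s * m == n)%N%:R : rat).
  rewrite mulr_sumr; apply: eq_bigr => s _; rewrite psumS0 /area big_seq1.
  by rewrite /monomial big_nat1.
case: ifP => [mdn|/negP mdn]; last first.
  rewrite big1 ?mulr0 // => s _; case: eqP => // e; case: mdn.
  by rewrite -e dvdn_mull.
(* The only cofactor of [m] is [n %/ m]. *)
have q0 : (0 < n %/ m)%N by rewrite divn_gt0.
have qn : (n %/ m < n.+1)%N by rewrite ltnS leq_div.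
rewrite big_mkcond (bigD1_seq (n %/ m)%N) /= ?iota_uniq ?mem_iota //.
rewrite divnK // eqxx q0 qn /= big1 ?addr0 ?mulr1 //.
move=> s sm; case: ifP => // _; case: eqP => // e.
by rewrite -e mulnK ?eqxx in sm.
Qed.

Definition detector (l j n : nat) : rat :=
  n%:R ^+ j * ((n%:R ^+ l + 1) * sigma 0 n - 2 * sigma l n).

Lemma mac_span_detector l j : mac_span (l.*2 + j.*2) (detector l j).
Proof.
apply: mac_span_exp; apply: mac_spanB.
  have := mac_spanD (mac_span_exp l (mac_span_sigma 0))
    (mac_span_le (leq0n (0 + l.*2)) (mac_span_sigma 0)).
  by apply: mac_span_ext => n; rewrite mulrDl mul1r.
by apply: mac_spanZ; apply: mac_span_le (mac_span_sigma l); rewrite -addnn leq_addr.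
Qed.

Lemma detector_sum l j n : detector l j n =
  n%:R ^+ j * \sum_(1 <= t < n.+1 | (t %| n)%N) (n%:R ^+ l + 1 - 2 * t%:R ^+ l).
Proof.
rewrite /detector /sigma sumrB -mulr_sumr; congr (_ * (_ - _)).
by rewrite mulr_sumr; apply: eq_bigr => t _; rewrite expr0 mulr1.
Qed.

(** The terms of the divisors 1 and [n] cancel. *)
Lemma detector_proper_divisors l j n : (1 < n)%N -> detector l j n =
  n%:R ^+ j * \sum_(2 <= t < n | (t %| n)%N) (n%:R ^+ l + 1 - 2 * t%:R ^+ l).
Proof.
move=> n1; rewrite detector_sum; congr (_ * _).
rewrite big_mkcond big_nat_recr ?(ltnW n1) //= dvdnn big_ltn //= dvd1n expr1n.
rewrite -big_mkcond /=; ring.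
Qed.

Lemma proper_divisor_term_gt0 l n t : (0 < l)%N -> (0 < t < n)%N -> (t %| n)%N ->
  0 < n%:R ^+ l + 1 - 2 * t%:R ^+ l :> rat.
Proof.
move=> l0 /andP[t0 tn] /dvdnP[q nE].
(* The cofactor [q] of a proper divisor is at least 2. *)
have h : (2 * t ^ l <= n ^ l)%N.
  have q2 : (2 <= q)%N by move: tn; rewrite nE; case: q {nE} => [|[|q]] //; lia.
  rewrite nE expnMn leq_mul // (leq_trans q2) //.
  by case: l l0 => // l _; rewrite expnS leq_pmulr // expn_gt0 (leq_trans _ q2).
by rewrite addrAC ltr_wpDl // -!natrX -natrM subr_ge0 ler_nat.
Qed.

Lemma detector_ge0 l j n : (0 < l)%N -> (0 < n)%N -> 0 <= detector l j n.
Proof.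
move=> l0; case: n => [|[|n]] // _.
  by rewrite detector_sum big_mkcond big_nat1 /= !expr1n; lra.
rewrite detector_proper_divisors // mulr_ge0 ?exprn_ge0 ?ler0n //.
rewrite big_nat_cond sumr_ge0 // => t /andP[/andP[t2 tn] td].
by rewrite ltW // proper_divisor_term_gt0 // tn (ltnW t2).
Qed.

Lemma detector_eq0 l j n : (0 < l)%N -> (1 < n)%N ->
  (detector l j n == 0) = prime n.
Proof.
move=> l0 n1; rewrite detector_proper_divisors // mulf_eq0 expf_eq0 pnatr_eq0.
rewrite gtn_eqF ?(ltnW n1) // andbF /=.
have [pn|npn] := boolP (prime n).
  rewrite big_nat_cond big1 // => t /andP[/andP[t2 tn] td].
  by move/primeP: pn => [_ /(_ t td) /orP[]/eqP tE]; rewrite tE ?ltnn in t2 tn.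
have [|[t /andP[t1 tn] td]] := primePn npn; first by rewrite ltnNge n1.
have tin : t \in index_iota 2 n by rewrite mem_index_iota t1 tn.
rewrite gt_eqF // big_mkcond (bigD1_seq t) ?iota_uniq //= td.
rewrite ltr_wpDr ?proper_divisor_term_gt0 // ?tn ?(ltnW t1) //.
rewrite big_seq_cond sumr_ge0 // => u /andP[+ _]; rewrite mem_index_iota => /andP[u2 un].
by case: ifP => // ud; rewrite ltW // proper_divisor_term_gt0 // un (ltnW u2).
Qed.

Lemma detector_expression l j : (0 < l)%N ->
  exists (c : coeffs) (lam : rat),
    [/\ prime_detecting (l.*2 + j.*2) c, 0 < lam
      & forall n, (expression c n)%:~R = lam * detector l j n].
Proof.
move=> l0.
(* Any composite number shows that the function is nonzero. *)
have d4 : detector l j 4 != 0 by rewrite detector_eq0.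
have [c [lam [lam0 bc gc Ec]]] := mac_span_coprime_expression (mac_span_detector l j) d4.
exists c, lam; split=> //; split=> // [n n0|n n2].
  by rewrite -(ler0z rat) Ec mulr_ge0 ?(ltW lam0) ?detector_ge0.
have <- : (expression c n == 0) = prime n.
  by rewrite -(intr_eq0 rat) Ec mulf_eq0 (gt_eqF lam0) detector_eq0.
by split=> /eqP.
Qed.

Lemma sigma_pq k p q : prime p -> prime q -> p != q ->
  sigma k (p * q) = 1 + p%:R ^+ k + q%:R ^+ k + (p%:R * q%:R) ^+ k.
Proof.
move=> pp pq npq; rewrite /sigma -big_filter.
have p1 := prime_gt1 pp; have q1 := prime_gt1 pq.
rewrite (perm_big [:: 1; p; q; p * q]%N); last first.
  apply: uniq_perm.
  - by rewrite filter_uniq // iota_uniq.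
  - have h1 : (p < p * q)%N by rewrite ltn_Pmulr // ltnW.
    have h2 : (q < p * q)%N by rewrite ltn_Pmull // ltnW.
    rewrite /= !inE !negb_or npq; move: (p * q)%N h1 h2 p1 q1 => m; lia.
  move=> t; rewrite mem_filter mem_index_iota !inE.
  apply/andP/idP => [[td _]|].
    have /dvdn_prime2 := pp.
    have [ptn|npt] := boolP (p %| t)%N.
      have /dvdnP[u tE] := ptn; move: td; rewrite tE mulnC dvdn_pmul2l ?(ltnW p1) //.
      move/primeP: pq => [_ h] /h /orP[]/eqP-> _; first by rewrite muln1 eqxx orbT.
      by rewrite eqxx !orbT.
    rewrite -prime_coprime // coprime_sym in npt.
    rewrite Gauss_dvdr // in td.
    by move/primeP: pq => [_ /(_ t td) /orP[]/eqP->] _; rewrite eqxx ?orbT.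
  have pq0 : (0 < p * q)%N by rewrite muln_gt0 !prime_gt0.
  move=> tl; have td : (t %| p * q)%N.
    by case/or4P: tl => /eqP->; [exact: dvd1n | exact: dvdn_mulr | exact: dvdn_mull |].
  by split=> //; rewrite ltnS (dvdn_gt0 pq0 td) dvdn_leq.
by rewrite !big_cons big_nil natrM expr1n /= addr0 !addrA.
Qed.

Lemma detector_pq l j p q : prime p -> prime q -> p != q ->
  detector l j (p * q) =
  2 * ((p%:R * q%:R) ^+ j * ((p%:R ^+ l - 1) * (q%:R ^+ l - 1))).
Proof.
move=> pp pq npq; rewrite /detector !sigma_pq // natrM !exprMn !expr0.
move: (p%:R ^+ l) (q%:R ^+ l) (p%:R ^+ j) (q%:R ^+ j) => a b c d; ring.
Qed.

(** There are infinitely many primes, hence too many roots. *)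
Lemma poly_eq0_of_primes (R : realType) (B : nat) (P : {poly R}) :
  (forall p, prime p -> (B < p)%N -> P.[p%:R] = 0) -> P = 0.
Proof.
move=> P0; apply/eqP; apply: contraT => nP.
have [rs srs rsP] : exists2 rs : seq nat, size rs = size P &
    uniq rs /\ {in rs, forall p, prime p && (B < p)%N}.
  elim: (size P) => [|k [rs srs [urs rsP]]]; first by exists [::].
  have [p lp pp] := prime_above (B + sumn rs).
  exists (p :: rs); first by rewrite /= srs.
  split=> [|x].
    rewrite /= urs andbT; apply: contraL lp => prs; rewrite -leqNgt.
    rewrite (leq_trans _ (leq_addl _ _)) // sumnE (big_rem p) //=.
    exact: leq_addr.
  rewrite inE => /orP[/eqP->|/rsP //]; rewrite pp.
  by rewrite (leq_ltn_trans _ lp) // leq_addr.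
case: rsP => urs rsP.
have := @max_poly_roots R P [seq p%:R | p <- rs] nP.
rewrite size_map srs ltnn => -> //.
  by apply/allP => _ /mapP[p /rsP /andP[pp Bp] ->]; apply/rootP/P0.
rewrite map_inj_uniq // => x y /eqP; rewrite eqr_nat; exact/eqP.
Qed.

(** * Linear independence and conclusion *)

Lemma prime_detecting_le d d' c :
  (d <= d')%N -> prime_detecting d c -> prime_detecting d' c.
Proof.
move=> dd' [bc gc pos van]; split=> // v /bc [sv dv]; split=> //.
exact: leq_trans dd'.
Qed.

(** A relation at all products [p * q] is a relation between the polynomials
    [Q_k(x) Q_k(y)] with [Q_k = X^(j + l) - X^j]: first [q] varies with [p] fixed,
    then [p] varies.  The coefficient of [x^(j + l) y^j] isolates one index,
    because in each product the exponent pairs off the diagonal are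
    [(j + l, j)] and its mirror image. *)
Lemma detector_family_free (R : realType) (N : nat) (l j : 'I_N -> nat)
    (b : 'I_N -> R) :
  (forall k, (0 < l k)%N) ->
  (forall k k', l k = l k' -> j k = j k' -> k = k') ->
  (forall p q, prime p -> prime q -> p != q ->
     \sum_k b k * ((p%:R * q%:R) ^+ j k *
                    ((p%:R ^+ l k - 1) * (q%:R ^+ l k - 1))) = 0) ->
  forall k, b k = 0.
Proof.
move=> l_gt0 lj_inj vanish k0.
pose Q k : {poly R} := 'X^(j k + l k) - 'X^(j k).
have QE k (x : R) : (Q k).[x] = x ^+ j k * (x ^+ l k - 1).
  by rewrite /Q !hornerE exprD mulrBr mulr1.
have vanish_q p y : prime p -> \sum_k b k * (Q k).[p%:R] * (Q k)`_y = 0.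
  move=> pp; pose P := \sum_k (b k * (Q k).[p%:R]) *: Q k.
  have P0 : P = 0.
    apply: (@poly_eq0_of_primes R p) => q pq ltpq.
    have npq : p != q by rewrite ltn_eqF.
    rewrite /P horner_sum -[RHS](vanish p q pp pq npq).
    apply: eq_bigr => k _; rewrite hornerZ !QE -mulrA; congr (_ * _).
    by rewrite exprMn mulrACA.
  have := congr1 (fun A : {poly R} => A`_y) P0; rewrite coef0 /P coef_sum => PE.
  by rewrite -[RHS]PE; apply: eq_bigr => k _; rewrite coefZ.
have vanish_pq x y : \sum_k b k * (Q k)`_y * (Q k)`_x = 0.
  pose P := \sum_k (b k * (Q k)`_y) *: Q k.
  have P0 : P = 0.
    apply: (@poly_eq0_of_primes R 0) => p pp _.
    rewrite /P horner_sum -[RHS](vanish_q _ y pp).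
    by apply: eq_bigr => k _; rewrite hornerZ mulrAC.
  have := congr1 (fun A : {poly R} => A`_x) P0; rewrite coef0 /P coef_sum => PE.
  by rewrite -[RHS]PE; apply: eq_bigr => k _; rewrite coefZ.
(* The exponent pair that occurs for the index [k0] only. *)
have := vanish_pq (j k0 + l k0)%N (j k0).
rewrite (bigD1 k0) //= big1 => [|k nk].
  have jl : (j k0 == j k0 + l k0)%N = false by have := l_gt0 k0; lia.
  rewrite addr0 /Q !coefB !coefXn !eqxx jl eq_sym jl subr0 sub0r mulrN1 mulr1.
  by move/eqP; rewrite oppr_eq0 => /eqP.
rewrite /Q !coefB !coefXn.
have [e1|n1] := eqVneq (j k0 + l k0)%N (j k); last first.
  have [e2|n2] := eqVneq (j k0 + l k0)%N (j k + l k)%N; last by rewrite subrr mulr0.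
  have [e3|n3] := eqVneq (j k0) (j k).
    by case/eqP: nk; apply: lj_inj => //; lia.
  have [e4|n4] := eqVneq (j k0) (j k + l k)%N; last by rewrite subrr mulr0 mul0r.
  by have := l_gt0 k0; lia.
have [e2|n2] := eqVneq (j k0) (j k); first by have := l_gt0 k0; lia.
have [e3|n3] := eqVneq (j k0) (j k + l k)%N; last by rewrite subrr mulr0 mul0r.
by have := l_gt0 k0; lia.
Qed.

Theorem theorem1p3 (R : realType) :
  (forall d : nat, (4 <= d)%N -> exists c : coeffs, prime_detecting d c) /\
  (exists (C : R) (d0 : nat), (0 < C)%R /\
    forall d : nat, (d0 <= d)%N ->
      exists (N : nat) (c : 'I_N -> coeffs),
        [/\ (C * d%:R ^+ 2 <= N%:R)%R,
            forall k : 'I_N, prime_detecting d (c k)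
          & lin_indep R (fun k : 'I_N => expression (c k))]).
Proof.
split=> [d d4|].
  have [c [lam [pc _ _]]] := detector_expression 0 (ltn0Sn 0).
  by exists c; apply: prime_detecting_le pc; lia.
exists (64%:R^-1), 4%N; split=> [|d d4]; first by rewrite invr_gt0.
(* The indices enumerate the pairs (l, j) with 1 <= l <= m and 0 <= j < m,
   for which 2l + 2j <= 4m <= d. *)
pose m := (d %/ 4)%N; pose l k := (k %/ m).+1; pose j k := (k %% m)%N.
have m0 : (0 < m)%N by rewrite divn_gt0.
have md : (4 * m <= d)%N by rewrite mulnC leq_divM.
have dm : (d <= 8 * m)%N.
  by have := divn_eq d 4; have := ltn_pmod d (isT : (0 < 4)%N); rewrite -/m; lia.
have ljb k : (k < m * m)%N -> ((l k).*2 + (j k).*2 <= d)%N.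
  move=> km; have : (l k <= m)%N by rewrite /l ltn_divLR.
  by have : (j k < m)%N by [rewrite ltn_pmod]; lia.
pose good (k : 'I_(m * m)) c := prime_detecting d c /\
  exists2 lam : rat, 0 < lam & forall n, (expression c n)%:~R = lam * detector (l k) (j k) n.
have [c Hc] : exists c : 'I_(m * m) -> coeffs, forall k, good k (c k).
  apply: (fin_all_exists (P := good)) => k.
  have [c [lam [pc lam0 Ec]]] := detector_expression (j k) (ltn0Sn (k %/ m)).
  exists c; split; last by exists lam.
  exact: prime_detecting_le (ljb k (ltn_ord k)) pc.
exists (m * m)%N, c; split=> [|k|a a0 k0].
- rewrite mulrC ler_pdivrMr // -!natrX -natrM ler_nat.
  by have := leq_mul dm dm; rewrite -!mulnn; lia.
- by case: (Hc k).
pose scale (k : 'I_(m * m)) lam := 0 < lam /\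
  forall n, (expression (c k) n)%:~R = lam * detector (l k) (j k) n :> rat.
have [lam Hlam] : exists lam : 'I_(m * m) -> rat, forall k, scale k (lam k).
  apply: (fin_all_exists (P := scale)) => k.
  by case: (Hc k) => _ [lam lam0 Ec]; exists lam.
have lamR k : ratr (lam k * 2) != 0 :> R.
  by rewrite fmorph_eq0 mulf_neq0 // gt_eqF //; case: (Hlam k).
suff: a k0 * ratr (lam k0 * 2) = 0.
  by move/eqP; rewrite mulf_eq0 (negPf (lamR k0)) orbF => /eqP.
apply: (@detector_family_free R (m * m) l j (fun k => a k * ratr (lam k * 2))) => //.
  move=> k k' [e1] e2; apply: val_inj => /=.
  by rewrite (divn_eq k m) (divn_eq k' m) e1 -/(j k) e2.
move=> p q pp pq npq.
rewrite -[RHS](a0 (p * q)%N) ?muln_gt0 ?prime_gt0 //.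
apply: eq_bigr => k _; rewrite -mulrA; congr (_ * _).
have [_ Ek] := Hlam k.
rewrite -[RHS](ratr_int R) Ek detector_pq // (mulrA (lam k) 2) [RHS]rmorphM; congr (_ * _).
by rewrite !(rmorphM, rmorphXn, rmorphB, rmorph1, rmorph_nat).
Qed.
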